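(* Let $k$ be a field and let $k(D,\Omega,\rho)$ be a generalized path algebra with weak relations. (i) The category $\mathrm{Rep}(D,\Omega,\rho)$ and the category ${}_{k(D,\Omega,\rho)}\mathcal{M}LU$ of local unitary $k(D,\Omega,\rho)$-modules are equivalent. (ii) If $D$ is finite (i.e. the vertex set $I$ is finite and the number of arrows between any two vertices is finite), then the full subcategories of finite dimensional objects of $\mathrm{Rep}(D,\Omega,\rho)$ and of ${}_{k(D,\Omega,\rho)}\mathcal{M}LU$ are equivalent.
   Context: Algebras are over $k$ and need not have a unity element; $r(\cdot)$ denotes the Jacobson radical. A (left) module $M$ over an algebra $A$ is *local unitary* if for every $x\in M$ there is $u\in A$ with $ux=x$. ${}_A\mathcal{M}LU$ is the category of local unitary $A$-modules, with $A$-module homomorphisms as morphisms. *Generalized path algebras.* Let $D$ be a directed graph (possibly infinite, possibly not simple) with non-empty vertex set $I=D_0$ and arrow set $D_1$. Let $\Omega=\bigoplus_{i\in I}\Omega_{ii}$ be a direct sum of $k$-algebras (with $\Omega_{ii}\Omega_{jj}=0$ for $i\ne j$), each $\Omega_{ii}$ having a non-zero unity element $e_{ii}$ and $r(\Omega_{ii})=0$. An $\Omega$-path from $i_0$ to $i_n$ of length $n$ is a sequence $a_{i_0}x_{i_0i_1}a_{i_1}x_{i_1i_2}\cdots x_{i_{n-1}i_n}a_{i_n}$, where $x_{i_{p-1}i_p}$ is an arrow from $i_{p-1}$ to $i_p$ and $0\ne a_{i_p}\in\Omega_{i_pi_p}$. For $i,j\in I$ let $A'_{ij}$ be the $k$-vector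 space with basis all $\Omega$-paths from $i$ to $j$ of length $>0$, and let $B_{ij}$ be the subspace spanned by all elements $$a_{i_0}x_{i_0i_1}a_{i_1}\cdots x_{i_{s-1}i_s}\big(a^{(1)}_{i_s}+\cdots+a^{(m)}_{i_s}\big)x_{i_si_{s+1}}\cdots x_{i_{n-1}i_n}a_{i_n}-\sum_{l=1}^m a_{i_0}x_{i_0i_1}a_{i_1}\cdots x_{i_{s-1}i_s}a^{(l)}_{i_s}x_{i_si_{s+1}}\cdots x_{i_{n-1}i_n}a_{i_n},$$ where $i_0=i$, $i_n=j$, $0\le s\le n$, $n,m$ are natural numbers, $a_{i_p}\in\Omega_{i_pi_p}$, $a^{(l)}_{i_s}\in\Omega_{i_si_s}$ and the $x_{i_pi_{p+1}}$ are arrows. Put $A_{ij}=A'_{ij}/B_{ij}$ if $i\ne j$ and $A_{ii}=(A'_{ii}+\Omega_{ii})/B_{ii}$. The generalized path algebra $k(D,\Omega)$ is the direct sum $\bigoplus_{i,j\in I}A_{ij}$, with multiplication $(xy)_{ij}=\sum_s x_{is}y_{sj}$ given by the $k$-linear maps $A_{ij}\otimes A_{jl}\to A_{il}$ induced by concatenation of $\Omega$-paths: the product of a path ending with $a_{i_n}$ and a path starting with $b_{j_0}$, where $i_n=j_0$, is obtained by joining them with middle entry $a_{i_n}b_{j_0}$ (and is $0$ if $a_{i_n}b_{j_0}=0$). For an arrow $x_{ij}$ from $i$ to $j$ one writes $e_{ii}x_{ij}=x_{ij}e_{jj}=x_{ij}$. Let $J$ be the ideal of $k(D,\Omega)$ generated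 by all arrows. For a non-empty subset $\rho\subseteq k(D,\Omega)$ let $(\rho)$ be the ideal generated by $\rho$ and $k(D,\Omega,\rho)=k(D,\Omega)/(\rho)$. It is a generalized path algebra *with weak relations* if $J^t\subseteq(\rho)\subseteq J$ for some $t$. *Representations.* A representation of $(D,\Omega)$ is $(V,f)=\{V_i,f_\alpha\}$, where each $V_i$ ($i\in I$) is a unitary $\Omega_{ii}$-module and, for each arrow $\alpha$ from $j$ to $i$ ($i,j\in I$), $f_\alpha:V_i\to V_j$ is a $k$-linear map. A morphism $h:(V,f)\to(V',f')$ is a family $\{h_i\}_{i\in I}$ of $k$-linear maps $h_i:V_i\to V'_i$ such that $h_jf_\alpha=f'_\alpha h_i$ for each arrow $\alpha$ from $j$ to $i$. These form the category $\mathrm{Rep}(D,\Omega)$. Given $(V,f)$, the direct sum $V$ of the $V_i$ is viewed as a $k(D,\Omega)$-module: an $\Omega$-path $a_{i_0}x_{i_0i_1}a_{i_1}\cdots x_{i_{n-1}i_n}a_{i_n}$ sends $v\in V_{i_n}$ to $a_{i_0}\cdot f_{x_{i_0i_1}}(a_{i_1}\cdot f_{x_{i_1i_2}}(\cdots f_{x_{i_{n-1}i_n}}(a_{i_n}\cdot v)))$ and acts as $0$ on $V_j$ for $j\ne i_n$ (for $n=0$ this is the action of $\Omega_{i_0i_0}$ on $V_{i_0}$). For $\sigma\in k(D,\Omega)$ let $f_\sigma:V\to V$, $f_\sigma(x)=\sigma\cdot x$. $\mathrm{Rep}(D,\Omega,\rho)$ is the full subcategory of $\mathrm{Rep}(D,\Omega)$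 whose objects are the $(V,f)$ with $f_\sigma=0$ for each $\sigma\in\rho$.
   Formalization: Morphisms of representations are families of Ω_ii-module homomorphisms h_i, not merely k-linear maps (false otherwise: one vertex, no arrow, Ω = M_2(k)); the relations B_ij are k-linear rather than additive in each entry, so that the product is well defined. *)

(* Defs.v *)
From HB Require Import structures.
From mathcomp Require Import all_boot all_order all_algebra.
From mathcomp Require Import boolp classical_sets functions.
From mathcomp Require Import cardinality fsbigop.

Set Implicit Arguments.
Unset Strict Implicit.
Unset Printing Implicit Defensive.

Import GRing.Theory.
Local Open Scope ring_scope.
Local Open Scope classical_set_scope.
Local Open Scope quotient_scope.

Record category := Category {
  obj :> Type;
  hom : obj -> obj -> Type;
  idc : forall a, hom a a;
  comp : forall a b c, hom b c -> hom a b -> hom a c;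
  comp_idl : forall a b (f : hom a b), comp (idc b) f = f;
  comp_idr : forall a b (f : hom a b), comp f (idc a) = f;
  compA : forall a b c d (f : hom c d) (g : hom b c) (h : hom a b),
    comp f (comp g h) = comp (comp f g) h }.
Arguments idc {_} _.
Arguments comp {_ _ _ _} _ _.

Record functor (C D : category) := Functor {
  fobj :> C -> D;
  fmap : forall a b, hom a b -> hom (fobj a) (fobj b);
  fmap_id : forall a, fmap (idc a) = idc (fobj a);
  fmap_comp : forall a b c (f : hom b c) (g : hom a b),
    fmap (comp f g) = comp (fmap f) (fmap g) }.
Arguments fmap {_ _} _ {_ _} _.

Definition idfunctor (C : category) : functor C C :=
  @Functor C C id (fun _ _ => id) (fun=> erefl) (fun _ _ _ _ _ => erefl).

Section CompFunctor.
Variables (C D E : category) (G : functor D E) (F : functor C D).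

Lemma compfunctor_id a : fmap G (fmap F (idc a)) = idc (G (F a)).
Proof. by rewrite !fmap_id. Qed.

Lemma compfunctor_comp a b c (f : hom b c) (g : hom a b) :
  fmap G (fmap F (comp f g)) = comp (fmap G (fmap F f)) (fmap G (fmap F g)).
Proof. by rewrite !fmap_comp. Qed.

Definition compfunctor : functor C E :=
  Functor compfunctor_id compfunctor_comp.
End CompFunctor.

Record nat_iso (C D : category) (F G : functor C D) := NatIso {
  ni_fun : forall a, hom (F a) (G a);
  ni_inv : forall a, hom (G a) (F a);
  ni_nat : forall a b (f : hom a b),
    comp (ni_fun b) (fmap F f) = comp (fmap G f) (ni_fun a);
  ni_invl : forall a, comp (ni_inv a) (ni_fun a) = idc (F a);
  ni_invr : forall a, comp (ni_fun a) (ni_inv a) = idc (G a) }.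

Definition equivalent (C D : category) : Prop :=
  exists (F : functor C D) (G : functor D C),
    inhabited (nat_iso (compfunctor G F) (idfunctor C)) /\
    inhabited (nat_iso (compfunctor F G) (idfunctor D)).

Definition full_subcategory (C : category) (P : C -> Prop) : category :=
  @Category {a : C | P a} (fun a b => hom (sval a) (sval b))
    (fun a => idc (sval a)) (fun _ _ _ f g => comp f g)
    (fun _ _ f => comp_idl f) (fun _ _ f => comp_idr f)
    (fun _ _ _ _ f g h => compA f g h).

Section Linear.
Variable k : fieldType.

Section DirectSum.
Variables (I : choiceType) (V : I -> lmodType k).

Record dsum := DSum {
  dsum_fun :> forall i, V i;
  dsum_fin : finite_set [set i | dsum_fun i != 0] }.

HB.instance Definition _ := gen_eqMixin dsum.
HB.instance Definition _ := gen_choiceMixin dsum.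

Implicit Types x y z : dsum.

Lemma dsum_ext x y : (forall i, x i = y i) -> x = y.
Proof.
case: x y => [x fx] [y fy] /= xy.
have exy : x = y by exact: functional_extensionality_dep.
by subst y; congr DSum; exact: Prop_irrelevance.
Qed.

Lemma dsum_suppP x : exists r : seq I, forall i, i \notin r -> x i = 0.
Proof.
have /finite_seqP[r rE] := dsum_fin x.
exists r => i ir; apply/eqP; apply: contraNT ir => xi0.
by have : [set i | x i != 0] i by []; rewrite rE.
Qed.

Lemma dsum_fin_seq (f : forall i, V i) (r : seq I) :
  (forall i, i \notin r -> f i = 0) -> finite_set [set i | f i != 0].
Proof.
move=> f0; apply: (@sub_finite_set _ _ [set` r]) => [i /=|]; last first.
  by apply/finite_seqP; exists r.
by apply: contraNT => /f0 ->.
Qed.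

Lemma dsum0_fin : finite_set [set i | (0 : V i) != 0].
Proof. by apply: (@dsum_fin_seq _ [::]). Qed.

Lemma dsumD_fin x y : finite_set [set i | x i + y i != 0].
Proof.
have [r xr] := dsum_suppP x; have [s ys] := dsum_suppP y.
apply: (@dsum_fin_seq _ (r ++ s)) => i.
by rewrite mem_cat negb_or => /andP[/xr -> /ys ->]; rewrite addr0.
Qed.

Lemma dsumN_fin x : finite_set [set i | - x i != 0].
Proof.
have [r xr] := dsum_suppP x.
by apply: (@dsum_fin_seq _ r) => i /xr ->; rewrite oppr0.
Qed.

Lemma dsumZ_fin (c : k) x : finite_set [set i | c *: x i != 0].
Proof.
have [r xr] := dsum_suppP x.
by apply: (@dsum_fin_seq _ r) => i /xr ->; rewrite scaler0.
Qed.

Definition dsum0 := DSum dsum0_fin.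
Definition dsumD x y := DSum (dsumD_fin x y).
Definition dsumN x := DSum (dsumN_fin x).
Definition dsumZ c x := DSum (dsumZ_fin c x).

Lemma dsumDA : associative dsumD.
Proof. by move=> x y z; apply: dsum_ext => i /=; rewrite addrA. Qed.
Lemma dsumDC : commutative dsumD.
Proof. by move=> x y; apply: dsum_ext => i /=; rewrite addrC. Qed.
Lemma dsumD0 : left_id dsum0 dsumD.
Proof. by move=> x; apply: dsum_ext => i /=; rewrite add0r. Qed.
Lemma dsumDN : left_inverse dsum0 dsumN dsumD.
Proof. by move=> x; apply: dsum_ext => i /=; rewrite addNr. Qed.

HB.instance Definition _ :=
  GRing.isZmodule.Build dsum dsumDA dsumDC dsumD0 dsumDN.

Lemma dsumZA a b x : dsumZ a (dsumZ b x) = dsumZ (a * b) x.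
Proof. by apply: dsum_ext => i /=; rewrite scalerA. Qed.
Lemma dsumZ1 : left_id 1 dsumZ.
Proof. by move=> x; apply: dsum_ext => i /=; rewrite scale1r. Qed.
Lemma dsumZDr : right_distributive dsumZ +%R.
Proof. by move=> a x y; apply: dsum_ext => i /=; rewrite scalerDr. Qed.
Lemma dsumZDl x : {morph dsumZ^~ x : a b / a + b}.
Proof. by move=> a b; apply: dsum_ext => i /=; rewrite scalerDl. Qed.

HB.instance Definition _ :=
  GRing.Zmodule_isLmodule.Build k dsum dsumZA dsumZ1 dsumZDr dsumZDl.

Lemma dsumDE x y i : (x + y) i = x i + y i. Proof. by []. Qed.
Lemma dsumZE c x i : (c *: x) i = c *: x i. Proof. by []. Qed.
Lemma dsum0E i : (0 : dsum) i = 0. Proof. by []. Qed.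

Lemma dsum_sumE (J : Type) (r : seq J) (F : J -> dsum) i :
  (\sum_(j <- r) F j) i = \sum_(j <- r) F j i.
Proof. by elim/big_rec2: _ => // j u v _ <-. Qed.

Lemma dsin_fin i (v : V i) :
  finite_set [set j | dfwith (fun j : I => 0 : V j) v j != 0].
Proof.
apply: (@dsum_fin_seq _ [:: i]) => j.
by rewrite inE eq_sym => /(dfwith_out (fun j : I => 0 : V j) v).
Qed.

Definition dsin i (v : V i) : dsum := DSum (dsin_fin v).

End DirectSum.

Lemma fsum_seq (I : choiceType) (W : zmodType) (f : I -> W) (r : seq I) :
  (forall i, i \notin r -> f i = 0) ->
  \sum_(i \in [set: I]) f i = \sum_(i <- undup r) f i.
Proof.
move=> f0; rewrite (@fsbigE _ _ _ _ _ (undup r)) ?undup_uniq //.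
  by apply: eq_bigl => i /=; apply: mem_set.
by move=> i _; rewrite mem_undup => /f0.
Qed.

Section Quotient.
Variables (V : lmodType k) (S : submodClosed V).

(* [submodClosed] is also meant for semirings, so that closure under opposites
   has to be recovered from closure under scaling. *)
Definition zmod_of_submod : {pred V} := S.
Lemma zmod_of_submod_closed : zmod_closed zmod_of_submod.
Proof.
split=> [|u v uS vS]; first exact: (@rpred0 _ S).
by rewrite (@rpredD _ S) // -scaleN1r (@rpredZ _ _ S).
Qed.
HB.instance Definition _ := GRing.isZmodClosed.Build V zmod_of_submod
  zmod_of_submod_closed.

Definition lquot : Type := Quotient.quot zmod_of_submod.
HB.instance Definition _ := GRing.Zmodule.on lquot.
HB.instance Definition _ := EqQuotient.on lquot.

Definition lqpi (v : V) : lquot := \pi v.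

Lemma lqpi_eq u v : (lqpi u = lqpi v) <-> (u - v \in S).
Proof.
rewrite -[_ \in S]/(u - v \in (zmod_of_submod : zmodClosed V)).
by rewrite Quotient.idealrBE; split=> /eqP.
Qed.

Lemma lqpiD u v : lqpi (u + v) = lqpi u + lqpi v.
Proof.
exact: (@Quotient.pi_add V (zmod_of_submod : zmodClosed V) u v).
Qed.

Lemma lqpiP (a : lquot) : exists v, a = lqpi v.
Proof. by exists (repr a); rewrite /lqpi reprK. Qed.

Definition lquotZ (c : k) (a : lquot) : lquot := lqpi (c *: repr a).

Lemma lqpiZ' c v : lqpi (c *: v) = lquotZ c (lqpi v).
Proof.
apply/lqpi_eq; rewrite -scalerBr rpredZ //.
by apply/lqpi_eq; rewrite /lqpi reprK.
Qed.

Lemma lquotZA a b x : lquotZ a (lquotZ b x) = lquotZ (a * b) x.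
Proof. by have [v ->] := lqpiP x; rewrite -!lqpiZ' scalerA. Qed.
Lemma lquotZ1 : left_id 1 lquotZ.
Proof. by move=> x; have [v ->] := lqpiP x; rewrite -!lqpiZ' scale1r. Qed.
Lemma lquotZDr : right_distributive lquotZ +%R.
Proof.
move=> a x y; have [u ->] := lqpiP x; have [v ->] := lqpiP y.
by rewrite -lqpiD -!lqpiZ' scalerDr lqpiD.
Qed.
Lemma lquotZDl x : {morph lquotZ^~ x : a b / a + b}.
Proof.
by move=> a b; have [u ->] := lqpiP x; rewrite -!lqpiZ' scalerDl lqpiD.
Qed.

HB.instance Definition _ :=
  GRing.Zmodule_isLmodule.Build k lquot lquotZA lquotZ1 lquotZDr lquotZDl.

Lemma lqpiZ c v : lqpi (c *: v) = c *: lqpi v. Proof. exact: lqpiZ'. Qed.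

Lemma lqpi_linear : linear lqpi.
Proof. by move=> c u v; rewrite lqpiD lqpiZ. Qed.

HB.instance Definition _ := GRing.isLinear.Build k V lquot _ lqpi lqpi_linear.

Lemma lqpi_lincomb m (c : 'I_m -> k) (v : 'I_m -> V) :
  lqpi (\sum_(l < m) c l *: v l) = \sum_(l < m) c l *: lqpi (v l).
Proof.
elim/big_rec2: _ => [|l x y _ <-]; last by rewrite lqpi_linear.
by rewrite -[RHS](scale0r (lqpi 0)) -lqpiZ scale0r.
Qed.

Lemma lqpi_mem v : v \in S -> lqpi v = 0.
Proof.
move=> vS; rewrite -[RHS](scale0r (lqpi 0)) -lqpiZ scale0r.
by apply/lqpi_eq; rewrite subr0.
Qed.

End Quotient.

Lemma linear_lincomb (V W : lmodType k) (f : V -> W) m (x : V) (c : 'I_m -> k)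
    (v : 'I_m -> V) : linear f ->
  f (x - \sum_(l < m) c l *: v l) = f x - \sum_(l < m) c l *: f (v l).
Proof.
move=> flin; pose g : {linear V -> W} :=
  HB.pack f (GRing.isLinear.Build k V W _ f flin).
rewrite -[f]/(g : _ -> _) linearB linear_sum; congr (_ - _).
by apply: eq_bigr => l _; rewrite linearZ.
Qed.

Section Span.
Variables (V : lmodType k) (S : set V).

Definition span : {pred V} := fun x =>
  `[< forall W : submodClosed V, (forall y, S y -> y \in W) -> x \in W >].

Lemma span_submod_closed : submod_closed span.
Proof.
split=> [|c u v /asboolP uS /asboolP vS]; apply/asboolP => W SW.
  exact: rpred0.
by rewrite rpredD ?rpredZ ?uS ?vS.
Qed.

HB.instance Definition _ := GRing.isSubmodClosed.Build k V span
  span_submod_closed.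

Lemma mem_span x : S x -> x \in span.
Proof. by move=> Sx; apply/asboolP => W; apply. Qed.

Lemma span_ker (W : lmodType k) (f : V -> W) :
  linear f -> (forall x, S x -> f x = 0) -> forall x, x \in span -> f x = 0.
Proof.
move=> flin fS x /asboolP.
pose g : {linear V -> W} := HB.pack f (GRing.isLinear.Build k V W _ f flin).
pose K : {pred V} := fun x => g x == 0.
have Kc : submod_closed K.
  split=> [|c u v /eqP u0 /eqP v0]; rewrite unfold_in; first by rewrite linear0.
  by rewrite linearP u0 v0 scaler0 addr0.
pose K' : submodClosed V := HB.pack K (GRing.isSubmodClosed.Build k V K Kc).
move=> /(_ K') xK; apply/eqP; apply: (xK _) => y Sy.
by apply/eqP; exact: fS.
Qed.

End Span.

Section Free.
Variable T : choiceType.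

Definition free := dsum (fun _ : T => (k^o : lmodType k)).
HB.instance Definition _ := GRing.Lmodule.on free.

Definition fbasis (t : T) : free := @dsin T (fun=> (k^o : lmodType k)) t 1.

Definition flift (W : lmodType k) (g : T -> W) (x : free) : W :=
  \sum_(t \in [set: T]) (x t : k) *: g t.

Lemma flift_seq (W : lmodType k) (g : T -> W) (x : free) (r : seq T) :
  (forall t, t \notin r -> x t = 0) ->
  flift g x = \sum_(t <- undup r) (x t : k) *: g t.
Proof. by move=> x0; apply: fsum_seq => t /x0 ->; rewrite scale0r. Qed.

Lemma flift_linear (W : lmodType k) (g : T -> W) : linear (flift g).
Proof.
move=> c x y; have [r xr] := dsum_suppP x; have [s ys] := dsum_suppP y.
have rs t : t \notin r ++ s -> x t = 0 /\ y t = 0.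
  by rewrite mem_cat negb_or => /andP[/xr -> /ys ->].
rewrite !(@flift_seq _ g _ (r ++ s)); first last.
- by move=> t /rs[xt yt]; rewrite dsumDE dsumZE xt yt scaler0 addr0.
- by move=> t /rs[].
- by move=> t /rs[].
rewrite scaler_sumr -big_split; apply: eq_bigr => t _ /=.
by rewrite scalerDl scalerA.
Qed.

Lemma flift_linear_fun (W : lmodType k) c (g h : T -> W) (x : free) :
  flift (fun t => c *: g t + h t) x = c *: flift g x + flift h x.
Proof.
have [r xr] := dsum_suppP x.
rewrite !(flift_seq _ xr) scaler_sumr -big_split; apply: eq_bigr => t _ /=.
by rewrite scalerDr !scalerA mulrC.
Qed.

Lemma flift_basis (W : lmodType k) (g : T -> W) t : flift g (fbasis t) = g t.
Proof.
rewrite (@flift_seq _ _ _ [:: t]) /=.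
  by rewrite big_seq1 /= dfwith_in scale1r.
by move=> s; rewrite inE eq_sym => ts; rewrite /= dfwith_out.
Qed.

Lemma free_sum (x : free) (r : seq T) :
  (forall t, t \notin r -> x t = 0) ->
  x = \sum_(t <- undup r) (x t : k) *: fbasis t.
Proof.
move=> x0; apply: dsum_ext => s; rewrite dsum_sumE.
have [sr|sr] := boolP (s \in r); last first.
  rewrite x0 // big_seq big1 // => t; rewrite mem_undup => tr.
  rewrite dsumZE /= dfwith_out ?scaler0 //.
  by apply: contraNneq sr => <-.
rewrite (bigD1_seq s) ?undup_uniq ?mem_undup //= dfwith_in.
rewrite big1 ?addr0; first by rewrite /GRing.scale /= mulr1.
by move=> t ts; rewrite dfwith_out ?scaler0.
Qed.

Lemma flift_unique (W : lmodType k) (f : free -> W) :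
  linear f -> forall x, f x = flift (fun t => f (fbasis t)) x.
Proof.
move=> flin x; have [r xr] := dsum_suppP x.
pose f' : {linear free -> W} :=
  HB.pack f (GRing.isLinear.Build k free W _ f flin).
rewrite (flift_seq _ xr) {1}(free_sum xr).
by rewrite -[f]/(f' : _ -> _) linear_sum; apply: eq_bigr => t _; rewrite linearZ.
Qed.

Lemma free_ext (W : lmodType k) (f g : free -> W) : linear f -> linear g ->
  (forall t, f (fbasis t) = g (fbasis t)) -> forall x, f x = g x.
Proof.
move=> fl gl fg x; rewrite (flift_unique fl) (flift_unique gl).
by congr flift; apply/funext.
Qed.

End Free.

Definition bilinear (U V W : lmodType k) (f : U -> V -> W) : Prop :=
  (forall v, linear (fun u => f u v)) /\ (forall u, linear (f u)).

Section Bilinear.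
Variables (U V W : lmodType k) (f : U -> V -> W).
Hypothesis fbl : bilinear f.

Lemma bil0l v : f 0 v = 0.
Proof.
by have := fbl.1 v (-1) 0 0; rewrite /= scaler0 addr0 scaleN1r addNr.
Qed.

Lemma bil0r u : f u 0 = 0.
Proof.
by have := fbl.2 u (-1) 0 0; rewrite /= scaler0 addr0 scaleN1r addNr.
Qed.

Lemma bil_suml (J : Type) (r : seq J) (F : J -> U) v :
  f (\sum_(j <- r) F j) v = \sum_(j <- r) f (F j) v.
Proof.
elim: r => [|j r IH]; first by rewrite !big_nil bil0l.
by rewrite !big_cons -IH -[F j in LHS]scale1r fbl.1 scale1r.
Qed.

Lemma bil_sumr (J : Type) (r : seq J) (F : J -> V) u :
  f u (\sum_(j <- r) F j) = \sum_(j <- r) f u (F j).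
Proof.
elim: r => [|j r IH]; first by rewrite !big_nil bil0r.
by rewrite !big_cons -IH -[F j in LHS]scale1r fbl.2 scale1r.
Qed.

End Bilinear.

Definition finite_dimensional (V : lmodType k) : Prop :=
  exists (n : nat) (f : {linear V -> 'rV[k]_n}), bijective f.

End Linear.

Section Jacobson.
Variable R : nzRingType.

Definition left_ideal (M : set R) : Prop :=
  [/\ M 0, forall x y, M x -> M y -> M (x + y) &
      forall a x, M x -> M (a * x)].

Definition maximal_left_ideal (M : set R) : Prop :=
  [/\ left_ideal M, M <> setT &
      forall N, left_ideal N -> M `<=` N -> N = M \/ N = setT].

Definition jacobson_radical : set R :=
  [set x | forall M, maximal_left_ideal M -> M x].

End Jacobson.
Arguments jacobson_radical : clear implicits.

Section Algebras.
Variable k : fieldType.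

Record nualg := NUAlg {
  nua_car :> lmodType k;
  nmul : nua_car -> nua_car -> nua_car;
  nmul_bilinear : bilinear nmul;
  nmulA : forall a b c, nmul a (nmul b c) = nmul (nmul a b) c }.

Record amodule (A : nualg) := AModule {
  am_car :> lmodType k;
  act : A -> am_car -> am_car;
  act_bilinear : bilinear act;
  actA : forall a b v, act (nmul a b) v = act a (act b v) }.

Section Modules.
Variable A : nualg.

Record ahom (M N : amodule A) := AHom {
  ahom_fun :> M -> N;
  ahom_linear : linear ahom_fun;
  ahom_act : forall a v, ahom_fun (act a v) = act a (ahom_fun v) }.

Lemma ahom_ext (M N : amodule A) (f g : ahom M N) : f =1 g -> f = g.
Proof.
case: f g => [f fl fa] [g gl ga] /= fg.
have efg : f = g by exact: funext.
by subst g; congr AHom; exact: Prop_irrelevance.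
Qed.

Definition ahom_id (M : amodule A) : ahom M M :=
  @AHom M M id (fun _ _ _ => erefl) (fun _ _ => erefl).

Section Comp.
Variables (M N P : amodule A) (g : ahom N P) (f : ahom M N).
Lemma ahom_comp_linear : linear (g \o f).
Proof. by move=> c u v; rewrite /= !ahom_linear. Qed.
Lemma ahom_comp_act a v : (g \o f) (act a v) = act a ((g \o f) v).
Proof. by rewrite /= !ahom_act. Qed.
Definition ahom_comp : ahom M P := AHom ahom_comp_linear ahom_comp_act.
End Comp.

Lemma ahom_idl M N (f : ahom M N) : ahom_comp (ahom_id N) f = f.
Proof. exact: ahom_ext. Qed.
Lemma ahom_idr M N (f : ahom M N) : ahom_comp f (ahom_id M) = f.
Proof. exact: ahom_ext. Qed.
Lemma ahom_compA M N P Q (f : ahom P Q) (g : ahom N P) (h : ahom M N) :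
  ahom_comp f (ahom_comp g h) = ahom_comp (ahom_comp f g) h.
Proof. exact: ahom_ext. Qed.

Definition module_category : category :=
  Category ahom_idl ahom_idr ahom_compA.

Definition local_unitary (M : amodule A) : Prop :=
  forall x : M, exists u : A, act u x = x.

Definition local_unitary_modules : category :=
  @full_subcategory module_category local_unitary.

Definition fd_module (M : local_unitary_modules) : Prop :=
  finite_dimensional (sval M).

Definition fd_local_unitary_modules : category := full_subcategory fd_module.

End Modules.

Section AlgNUAlg.
Variable R : algType k.
Lemma alg_bilinear : bilinear (fun x y : R => x * y).
Proof.
by split=> z c x y /=; [rewrite mulrDl -scalerAl|rewrite mulrDr -scalerAr].
Qed.
Definition alg_nualg : nualg := NUAlg alg_bilinear (@mulrA R).
End AlgNUAlg.

Definition unitary (R : algType k) (M : amodule (alg_nualg R)) : Prop :=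
  forall v : M, @act (alg_nualg R) M (1 : R) v = v.

Section Ideals.
Variable A : nualg.

Definition two_sided (W : {pred A}) : Prop :=
  forall a x, x \in W -> nmul a x \in W /\ nmul x a \in W.

Definition ideal_gen (S : set A) : {pred A} := fun x =>
  `[< forall W : submodClosed A, two_sided W ->
        (forall y, S y -> y \in W) -> x \in W >].

Lemma ideal_gen_submod S : submod_closed (ideal_gen S).
Proof.
split=> [|c u v /asboolP uS /asboolP vS]; apply/asboolP => W W2 SW.
  exact: rpred0.
by rewrite rpredD ?rpredZ ?uS ?vS.
Qed.

HB.instance Definition _ S := GRing.isSubmodClosed.Build k A (ideal_gen S)
  (ideal_gen_submod S).

Lemma ideal_gen_two_sided S : two_sided (ideal_gen S).
Proof.
move=> a x /asboolP xS; split; apply/asboolP => W W2 SW.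
  by have [] := W2 a x (xS W W2 SW).
by have [] := W2 a x (xS W W2 SW).
Qed.

Lemma mem_ideal_gen S x : S x -> x \in ideal_gen S.
Proof. by move=> Sx; apply/asboolP => W _; apply. Qed.

(* J^0 is the whole algebra and J^1 = J; the latter is a separate case because
   the algebra need not have a unity. *)
Fixpoint ideal_pow (J : {pred A}) (t : nat) : {pred A} :=
  match t with
  | 0 => predT
  | 1 => J
  | t'.+1 => span [set z | exists x y,
               [/\ x \in ideal_pow J t', y \in J & z = nmul x y]]
  end.

Section QuotientAlgebra.
Variable S : set A.
Let W : submodClosed A := ideal_gen S.

Definition qmul (a b : lquot W) : lquot W := lqpi W (nmul (repr a) (repr b)).

Lemma qmul_pi x y : qmul (lqpi W x) (lqpi W y) = lqpi W (nmul x y).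
Proof.
have eqm (u v : A) : lqpi W u = lqpi W v -> u - v \in W by move=> /lqpi_eq.
have [mDl mDr] := nmul_bilinear A.
have hx : repr (lqpi W x) - x \in W by apply: eqm; rewrite /lqpi reprK.
have hy : repr (lqpi W y) - y \in W by apply: eqm; rewrite /lqpi reprK.
apply/lqpi_eq; set x' := repr _ in hx *; set y' := repr _ in hy *.
have -> : nmul x' y' - nmul x y = nmul (x' - x) y' + nmul x (y' - y).
  have := mDl y' (-1) x x'; rewrite !scaleN1r ![- x + _]addrC => ->.
  have := mDr x (-1) y y'; rewrite !scaleN1r ![- y + _]addrC => ->.
  by rewrite [RHS]addrC addrA addrK addrC.
by rewrite rpredD //; [have [] := ideal_gen_two_sided y' hx
  |have [] := ideal_gen_two_sided x hy].
Qed.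

Lemma qmul_bilinear : bilinear qmul.
Proof.
have [mDl mDr] := nmul_bilinear A.
split=> z c x y; have [x' ->] := lqpiP x; have [y' ->] := lqpiP y;
  have [z' ->] := lqpiP z; rewrite -lqpi_linear !qmul_pi.
  by rewrite mDl lqpi_linear.
by rewrite mDr lqpi_linear.
Qed.

Lemma qmulA a b c : qmul a (qmul b c) = qmul (qmul a b) c.
Proof.
have [x ->] := lqpiP a; have [y ->] := lqpiP b; have [z ->] := lqpiP c.
by rewrite !qmul_pi nmulA.
Qed.

Definition quotient_alg : nualg := NUAlg qmul_bilinear qmulA.

End QuotientAlgebra.

End Ideals.

End Algebras.

Section PathAlgebra.
Variables (k : fieldType) (I : choiceType) (D : I -> I -> Type).
Variable Omega : I -> algType k.

(* [OPpoint a] is the path a of length 0; [OPcons a x p] is the path that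
   starts with the entry a and the arrow x and goes on with p. Entries may be
   0 here: the relations [path_rel] below, with m = 0, identify such paths
   with 0. *)
Inductive opath : I -> I -> Type :=
| OPpoint i of Omega i : opath i i
| OPcons i j l of Omega i & D i j & opath j l : opath i l.

HB.instance Definition _ i j := gen_eqMixin (opath i j).
HB.instance Definition _ i j := gen_choiceMixin (opath i j).

Definition olmul i j (b : Omega i) (p : opath i j) : opath i j :=
  match p in opath i j return Omega i -> opath i j with
  | OPpoint _ a => fun b => OPpoint (b * a)
  | OPcons _ _ _ a x p => fun b => OPcons (b * a) x p
  end b.

Fixpoint ocat i j l (p : opath i j) : opath j l -> opath i l :=
  match p in opath i j return opath j l -> opath i l with
  | OPpoint _ a => fun q => olmul a q
  | OPcons _ _ _ a x p => fun q => OPcons a x (ocat p q)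
  end.

Lemma olmulA i j (a b : Omega i) (p : opath i j) :
  olmul a (olmul b p) = olmul (a * b) p.
Proof. by case: p a b => [? c|? ? ? c x p] a b /=; rewrite mulrA. Qed.

Lemma ocat_olmul i j l (a : Omega i) (p : opath i j) (q : opath j l) :
  ocat (olmul a p) q = olmul a (ocat p q).
Proof. by case: p a q => [? c|? ? ? c x p] a q //=; rewrite olmulA. Qed.

Lemma ocatA h i j l (p : opath h i) (q : opath i j) (r : opath j l) :
  ocat p (ocat q r) = ocat (ocat p q) r.
Proof.
elim: p q => [? a|? ? ? a x p IH] q /=; first by rewrite ocat_olmul.
by rewrite IH.
Qed.

Definition fpath i j := free k (opath i j).
Definition fpathb i j (p : opath i j) : fpath i j := fbasis k p.

(* The generators of B_ij: one entry of the path is a combination of elements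
   of Omega_ss. The entry of p.(a).q at that vertex s is b a c, where b is the
   last entry of p and c the first entry of q, so that b = c = 1 gives every
   path with any of its entries singled out. The coefficients c_l, which are 1
   in the usual presentation, make the class of a path k-linear, and not only
   additive, in each entry: concatenation is k-bilinear on A_ij x A_jl only
   then.
   Paths of length 0 are included, and in length 0 the quotient by these
   relations is Omega_ii: see [path_cls_pointD], [path_cls_pointM] and
   [path_cls_point_inj]. Thus [path_A i i] below is (A'_ii + Omega_ii) / B_ii. *)
Definition path_rel i j : set (fpath i j) := [set z | exists s
  (p : opath i s) (q : opath s j) (m : nat) (c : 'I_m -> k)
  (a : 'I_m -> Omega s),
  z = fpathb (ocat p (ocat (OPpoint (\sum_(l < m) c l *: a l)) q))
    - \sum_(l < m) c l *: fpathb (ocat p (ocat (OPpoint (a l)) q))].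

Definition path_B i j : submodClosed (fpath i j) := span (@path_rel i j).

Definition path_A i j : lmodType k := lquot (path_B i j).

Definition path_cls i j (p : opath i j) : path_A i j :=
  lqpi (path_B i j) (fpathb p).


Definition fmul i j l (x : fpath i j) (y : fpath j l) : fpath i l :=
  flift (fun p => flift (fun q => fpathb (ocat p q)) y) x.

Lemma fmul_bilinear i j l : bilinear (@fmul i j l).
Proof.
split=> [y|x]; first exact: flift_linear.
move=> c u v; rewrite /fmul -flift_linear_fun.
by congr flift; apply/funext => p; rewrite flift_linear.
Qed.

Lemma fmul_basis i j l (p : opath i j) (q : opath j l) :
  fmul (fpathb p) (fpathb q) = fpathb (ocat p q).
Proof. by rewrite /fmul !flift_basis. Qed.

Lemma fmulA i j l m (x : fpath i j) (y : fpath j l) (z : fpath l m) :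
  fmul x (fmul y z) = fmul (fmul x y) z.
Proof.
have mDl a b c := (fmul_bilinear a b c).1.
have mDr a b c := (fmul_bilinear a b c).2.
apply: (free_ext (f := fun x => fmul x (fmul y z))
                 (g := fun x => fmul (fmul x y) z)) x => [||p].
- exact: mDl.
- by move=> c u v; rewrite !mDl.
apply: (free_ext (f := fun y => fmul (fpathb p) (fmul y z))
                 (g := fun y => fmul (fmul (fpathb p) y) z)) y => [||q].
- by move=> c u v; rewrite mDl mDr.
- by move=> c u v; rewrite mDr mDl.
apply: (free_ext (f := fun z => fmul (fpathb p) (fmul (fpathb q) z))
                 (g := fun z => fmul (fmul (fpathb p) (fpathb q)) z)) z
  => [||r].
- by move=> c u v; rewrite !mDr.
- exact: mDr.
by rewrite !fmul_basis ocatA.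
Qed.

Lemma path_rel_pi i s j (p : opath i s) (q : opath s j) m (c : 'I_m -> k)
    (a : 'I_m -> Omega s) :
  path_cls (ocat p (ocat (OPpoint (\sum_(l < m) c l *: a l)) q))
  = \sum_(l < m) c l *: path_cls (ocat p (ocat (OPpoint (a l)) q)).
Proof.
apply: etrans (lqpi_lincomb _ _ _); apply/lqpi_eq/mem_span.
by exists s, p, q, m, c, a.
Qed.

Lemma fmul_Bl i j l (x : fpath i j) (y : fpath j l) :
  x \in path_B i j -> lqpi (path_B i l) (fmul x y) = 0.
Proof.
have [mDl mDr] := fmul_bilinear i j l.
move: x; apply: span_ker => [c u v|_ [s [p [q [m [c [a ->]]]]]]].
  by rewrite mDl lqpi_linear.
set z := (X in fmul X _).
apply: (free_ext (f := fun y => lqpi (path_B i l) (fmul z y))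
                 (g := fun=> 0)) y => [||r].
- by move=> d u v; rewrite mDr lqpi_linear.
- by move=> d u v; rewrite scaler0 addr0.
apply/lqpi_mem/mem_span; exists s, p, (ocat q r), m, c, a.
rewrite /z (linear_lincomb (f := fun x => fmul x _)) //.
rewrite fmul_basis -!ocatA; congr (_ - _).
by apply: eq_bigr => n _; rewrite fmul_basis -!ocatA.
Qed.

Lemma fmul_Br i j l (x : fpath i j) (y : fpath j l) :
  y \in path_B j l -> lqpi (path_B i l) (fmul x y) = 0.
Proof.
have [mDl mDr] := fmul_bilinear i j l.
move: y; apply: span_ker => [c u v|_ [s [p [q [m [c [a ->]]]]]]].
  by rewrite mDr lqpi_linear.
set z := (X in fmul _ X).
apply: (free_ext (f := fun x => lqpi (path_B i l) (fmul x z))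
                 (g := fun=> 0)) x => [||r].
- by move=> d u v; rewrite mDl lqpi_linear.
- by move=> d u v; rewrite scaler0 addr0.
apply/lqpi_mem/mem_span; exists s, (ocat r p), q, m, c, a.
rewrite /z linear_lincomb // fmul_basis ocatA; congr (_ - _).
by apply: eq_bigr => n _; rewrite fmul_basis ocatA.
Qed.

Definition path_mul i j l (a : path_A i j) (b : path_A j l) : path_A i l :=
  lqpi (path_B i l)
    (fmul (repr (a : lquot (path_B i j))) (repr (b : lquot (path_B j l)))).

Lemma path_mul_pi i j l (x : fpath i j) (y : fpath j l) :
  path_mul (lqpi (path_B i j) x) (lqpi (path_B j l) y)
  = lqpi (path_B i l) (fmul x y).
Proof.
have [mDl mDr] := fmul_bilinear i j l.
have hx : repr (lqpi (path_B i j) x) - x \in path_B i j.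
  by apply/lqpi_eq; rewrite /lqpi reprK.
have hy : repr (lqpi (path_B j l) y) - y \in path_B j l.
  by apply/lqpi_eq; rewrite /lqpi reprK.
rewrite /path_mul; set x' := repr _ in hx *; set y' := repr _ in hy *.
transitivity (lqpi (path_B i l) (fmul x y')).
  rewrite -[in LHS](subrK x x') -[x' - x]scale1r mDl lqpi_linear.
  by rewrite fmul_Bl // scaler0 add0r.
rewrite -[in LHS](subrK y y') -[y' - y]scale1r mDr lqpi_linear.
by rewrite fmul_Br // scaler0 add0r.
Qed.

Lemma path_mul_cls i j l (p : opath i j) (q : opath j l) :
  path_mul (path_cls p) (path_cls q) = path_cls (ocat p q).
Proof. by rewrite path_mul_pi fmul_basis. Qed.

Lemma path_mul_bilinear i j l : bilinear (@path_mul i j l).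
Proof.
have [mDl mDr] := fmul_bilinear i j l.
split=> z c x y; have [x' ->] := lqpiP x; have [y' ->] := lqpiP y;
  have [z' ->] := lqpiP z; rewrite -lqpi_linear !path_mul_pi.
  by rewrite mDl lqpi_linear.
by rewrite mDr lqpi_linear.
Qed.

Lemma path_mulA i j l m (a : path_A i j) (b : path_A j l) (c : path_A l m) :
  path_mul a (path_mul b c) = path_mul (path_mul a b) c.
Proof.
have [x ->] := lqpiP a; have [y ->] := lqpiP b; have [z ->] := lqpiP c.
by rewrite !path_mul_pi fmulA.
Qed.

Definition opoint i j (p : opath i j) : Omega i :=
  match p in opath i j return Omega i with
  | OPpoint _ a => a
  | OPcons _ _ _ _ _ _ => 0
  end.

Lemma opoint_linear i s j (p : opath i s) (q : opath s j) :
  linear (fun a => opoint (ocat p (ocat (OPpoint a) q))).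
Proof.
case: p q => [? b|? ? ? b x p] q c u v; last by rewrite /= scaler0 addr0.
case: q b c u v => [? d|? ? ? d x q] b c u v /=.
  by rewrite mulrDl mulrDr -scalerAl -scalerAr.
by rewrite scaler0 addr0.
Qed.

Lemma path_cls_point_inj i : injective (fun a : Omega i => path_cls (OPpoint a)).
Proof.
move=> a b /lqpi_eq ab; apply/eqP; rewrite -subr_eq0; apply/eqP.
pose f : fpath i i -> Omega i := flift (@opoint i i).
have flin : linear f by exact: flift_linear.
have fB x : x \in path_B i i -> f x = 0.
  apply: span_ker => // _ [s [p [q [m [c [e ->]]]]]].
  rewrite linear_lincomb // /f flift_basis.
  pose g : {linear Omega s -> Omega i} :=
    HB.pack (fun a => opoint (ocat p (ocat (OPpoint a) q)))
      (GRing.isLinear.Build k _ _ _ _ (opoint_linear p q)).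
  rewrite -[X in X - _]/(g _) linear_sum.
  apply/eqP; rewrite subr_eq0; apply/eqP/eq_bigr => l _.
  by rewrite linearZ /= flift_basis.
have := fB _ ab; rewrite -scaleN1r addrC flin /f !flift_basis /= => <-.
by rewrite scaleN1r addrC.
Qed.

Lemma path_cls_pointD i c (a b : Omega i) :
  path_cls (OPpoint (c *: a + b))
  = c *: path_cls (OPpoint a) + path_cls (OPpoint b).
Proof.
have := @path_rel_pi i i i (OPpoint 1) (OPpoint 1) 2
  (fun l => if l == ord0 then c else 1) (fun l => if l == ord0 then a else b).
by rewrite !big_ord_recl !big_ord0 /= !addr0 !scale1r !mulr1 !mul1r.
Qed.

Lemma path_cls_pointM i (a b : Omega i) :
  path_mul (path_cls (OPpoint a)) (path_cls (OPpoint b))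
  = path_cls (OPpoint (a * b)).
Proof. by rewrite path_mul_cls. Qed.

Notation gpath := (dsum (fun p : I * I => path_A p.1 p.2)).

Implicit Types x y z : gpath.

Lemma gpath_row x i :
  exists r : seq I, forall s, s \notin r -> x (i, s) = 0.
Proof.
have [r xr] := dsum_suppP x; exists [seq p.2 | p <- r] => s sr.
by apply: xr; apply: contraNN sr => /(map_f snd).
Qed.

Lemma gpath_col x j :
  exists r : seq I, forall s, s \notin r -> x (s, j) = 0.
Proof.
have [r xr] := dsum_suppP x; exists [seq p.1 | p <- r] => s sr.
by apply: xr; apply: contraNN sr => /(map_f fst).
Qed.

Definition gpath_mul_fun x y (p : I * I) : path_A p.1 p.2 :=
  \sum_(s \in [set: I]) @path_mul p.1 s p.2 (x (p.1, s)) (y (s, p.2)).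

Lemma gpath_mul_seq x y p (r : seq I) :
  (forall s, s \notin r -> x (p.1, s) = 0 \/ y (s, p.2) = 0) ->
  gpath_mul_fun x y p
  = \sum_(s <- undup r) @path_mul p.1 s p.2 (x (p.1, s)) (y (s, p.2)).
Proof.
have bl := path_mul_bilinear.
by move=> r0; apply: fsum_seq => s /r0[] ->; rewrite (bil0l, bil0r).
Qed.

Lemma gpath_mul_fin x y : finite_set [set p | gpath_mul_fun x y p != 0].
Proof.
have bl := path_mul_bilinear.
have [r xr] := dsum_suppP x; have [t yt] := dsum_suppP y.
apply: (@dsum_fin_seq _ _ _ _ [seq (p.1, q.2) | p <- r, q <- t]) => -[i j] ij.
rewrite (@gpath_mul_seq _ _ _ [::]) ?big_nil //= => s _.
have [isr|/xr ->] := boolP ((i, s) \in r); last by left.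
have [sjt|/yt ->] := boolP ((s, j) \in t); last by right.
by case/negP: ij; apply/allpairsP; exists ((i, s), (s, j)).
Qed.

Definition gpath_mul x y : gpath := DSum (gpath_mul_fin x y).

Lemma gpath_mul_bilinear : bilinear gpath_mul.
Proof.
split=> [z|z] c x y; apply: dsum_ext => -[i j] /=.
  have [r zr] := gpath_col z j.
  rewrite !(@gpath_mul_seq _ z _ r);
    try by move=> s /zr ->; right.
  rewrite scaler_sumr -big_split; apply: eq_bigr => s _ /=.
  exact: (path_mul_bilinear _ _ _).1.
have [r zr] := gpath_row z i.
rewrite !(@gpath_mul_seq z _ _ r);
  try by move=> s /zr ->; left.
rewrite scaler_sumr -big_split; apply: eq_bigr => s _ /=.
exact: (path_mul_bilinear _ _ _).2.
Qed.

Lemma gpath_mulA x y z :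
  gpath_mul x (gpath_mul y z) = gpath_mul (gpath_mul x y) z.
Proof.
apply: dsum_ext => -[i j].
have [r xr] := gpath_row x i; have [t zt] := gpath_col z j.
rewrite /= (@gpath_mul_seq _ _ _ r); last by move=> s /xr ->; left.
rewrite (@gpath_mul_seq _ _ _ t); last by move=> s /zt ->; right.
under eq_bigr => s _.
  rewrite /= (@gpath_mul_seq _ _ _ t); last by move=> u /zt ->; right.
  rewrite (bil_sumr (path_mul_bilinear _ _ _)).
  over.
rewrite exchange_big /=; apply: eq_bigr => u _.
rewrite (@gpath_mul_seq _ _ _ r); last by move=> s /xr ->; left.
rewrite (bil_suml (path_mul_bilinear _ _ _)).
by apply: eq_bigr => s _; rewrite path_mulA.
Qed.

Definition gpath_alg : nualg k := NUAlg gpath_mul_bilinear gpath_mulA.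

Definition entry (x : gpath_alg) i j : path_A i j := (x : gpath) (i, j).

Definition gpath_elt i j (p : opath i j) : gpath_alg :=
  @dsin k _ (fun p : I * I => path_A p.1 p.2) (i, j) (path_cls p).

(* The arrow x, that is, the path e_ii x e_jj. *)
Definition arrow_elt i j (x : D i j) : gpath_alg :=
  gpath_elt (OPcons 1 x (OPpoint 1)).

Definition arrow_ideal : {pred gpath_alg} :=
  ideal_gen [set z | exists i j (x : D i j), z = arrow_elt x].

Definition weak_relations (rho : set gpath_alg) : Prop :=
  exists t : nat, {subset ideal_pow arrow_ideal t <= ideal_gen rho} /\
                  {subset ideal_gen rho <= arrow_ideal}.

Definition finite_quiver : Prop :=
  finite_set [set: I] /\ forall i j, finite_set [set: D i j].

End PathAlgebra.

Section Representations.
Variables (k : fieldType) (I : choiceType) (D : I -> I -> Type).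
Variable Omega : I -> algType k.

(* An arrow x from i to j acts from V_j to V_i. *)
Record rep := Rep {
  rep_mod :> forall i, amodule (alg_nualg (Omega i));
  rep_unitary : forall i, unitary (rep_mod i);
  rep_map : forall i j, D i j -> {linear rep_mod j -> rep_mod i} }.

(* The components are Omega_ii-linear, not only k-linear: with k-linear
   components and no arrows, all structure given by Omega would be lost. *)
Record rep_hom (V W : rep) := RepHom {
  rep_hom_fun :> forall i, ahom (V i) (W i);
  rep_hom_comm : forall i j (x : D i j) (v : V j),
    rep_hom_fun i (rep_map V x v) = rep_map W x (rep_hom_fun j v) }.

Lemma rep_hom_ext (V W : rep) (f g : rep_hom V W) :
  (forall i, f i =1 g i) -> f = g.
Proof.
case: f g => [f fc] [g gc] /= fg.
have efg : f = g.
  by apply: functional_extensionality_dep => i; apply: ahom_ext; exact: fg.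
by subst g; congr RepHom; exact: Prop_irrelevance.
Qed.

Definition rep_id (V : rep) : rep_hom V V :=
  @RepHom V V (fun i => ahom_id (V i)) (fun _ _ _ _ => erefl).

Section Comp.
Variables (U V W : rep) (g : rep_hom V W) (f : rep_hom U V).
Lemma rep_comp_comm i j (x : D i j) (v : U j) :
  ahom_comp (g i) (f i) (rep_map U x v)
  = rep_map W x (ahom_comp (g j) (f j) v).
Proof. by rewrite /= !rep_hom_comm. Qed.
Definition rep_comp : rep_hom U W :=
  @RepHom U W (fun i => ahom_comp (g i) (f i)) rep_comp_comm.
End Comp.

Lemma rep_idl V W (f : rep_hom V W) : rep_comp (rep_id W) f = f.
Proof. exact: rep_hom_ext. Qed.
Lemma rep_idr V W (f : rep_hom V W) : rep_comp f (rep_id V) = f.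
Proof. exact: rep_hom_ext. Qed.
Lemma rep_compA U V W X (f : rep_hom W X) (g : rep_hom V W) (h : rep_hom U V) :
  rep_comp f (rep_comp g h) = rep_comp (rep_comp f g) h.
Proof. exact: rep_hom_ext. Qed.

Definition rep_category : category := Category rep_idl rep_idr rep_compA.

Section Action.
Variable V : rep.

Fixpoint opath_act i j (p : opath D Omega i j) : V j -> V i :=
  match p in opath _ _ i j return V j -> V i with
  | OPpoint _ a => @act k (alg_nualg (Omega _)) (V _) a
  | OPcons _ _ _ a x p => fun v =>
      @act k (alg_nualg (Omega _)) (V _) a (rep_map V x (opath_act p v))
  end.

Lemma opath_act_linear i j (p : opath D Omega i j) : linear (opath_act p).
Proof.
elim: p => [{}i a|{}i {}j l a x p IH] c u v /=; first exact: (act_bilinear _).2.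
by rewrite IH linearP (act_bilinear _).2.
Qed.

Lemma opath_act_olmul i j (b : Omega i) (p : opath D Omega i j) v :
  opath_act (olmul b p) v
  = @act k (alg_nualg (Omega i)) (V i) b (opath_act p v).
Proof.
by case: p b v => [{}i a|{}i {}j l a x p] b v /=;
  rewrite -(@actA k (alg_nualg (Omega i))).
Qed.

Lemma opath_act_ocat i j l (p : opath D Omega i j) (q : opath D Omega j l) v :
  opath_act (ocat p q) v = opath_act p (opath_act q v).
Proof.
elim: p q v => [{}i a|{}i {}j m a x p IH] q v /=; first exact: opath_act_olmul.
by rewrite IH.
Qed.

Definition fpath_act i j (x : fpath D Omega i j) (v : V j) : V i :=
  flift (fun p => opath_act p v) x.

Lemma fpath_act_bilinear i j : bilinear (@fpath_act i j).
Proof.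
split=> [v|x]; first exact: flift_linear.
move=> c u v; rewrite /fpath_act -flift_linear_fun.
by congr flift; apply/funext => p; rewrite opath_act_linear.
Qed.

Lemma fpath_act_B i j (x : fpath D Omega i j) (v : V j) :
  x \in path_B D Omega i j -> fpath_act x v = 0.
Proof.
move: x; apply: span_ker => [|_ [s [p [q [m [c [a ->]]]]]]].
  exact: (fpath_act_bilinear _ _).1.
rewrite (linear_lincomb (f := fun x => fpath_act x v)); last first.
  exact: (fpath_act_bilinear _ _).1.
pose w := opath_act q v.
have fl : linear (fun b : Omega s =>
    opath_act p (@act k (alg_nualg (Omega s)) (V s) b w)).
  by move=> d b b'; rewrite (act_bilinear _).1 opath_act_linear.
pose g : {linear Omega s -> V i} :=
  HB.pack (fun b : Omega s =>
      opath_act p (@act k (alg_nualg (Omega s)) (V s) b w))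
    (GRing.isLinear.Build k _ _ _ _ fl).
have gE b : fpath_act (fpathb (ocat p (ocat (OPpoint D b) q))) v = g b.
  by rewrite /fpath_act flift_basis !opath_act_ocat.
apply/eqP; rewrite subr_eq0; apply/eqP; rewrite gE linear_sum.
by apply: eq_bigr => l _; rewrite linearZ gE.
Qed.

Definition path_act i j (a : path_A D Omega i j) (v : V j) : V i :=
  fpath_act (repr (a : lquot (path_B D Omega i j))) v.

Lemma path_act_pi i j (x : fpath D Omega i j) (v : V j) :
  path_act (lqpi (path_B D Omega i j) x) v = fpath_act x v.
Proof.
have [aDl _] := fpath_act_bilinear i j.
have hx : repr (lqpi (path_B D Omega i j) x) - x \in path_B D Omega i j.
  by apply/lqpi_eq; rewrite /lqpi reprK.
rewrite /path_act; set x' := repr _ in hx *.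
rewrite -[in LHS](subrK x x') -[x' - x]scale1r aDl.
by rewrite fpath_act_B // scaler0 add0r.
Qed.

Lemma path_act_cls i j (p : opath D Omega i j) (v : V j) :
  path_act (path_cls p) v = opath_act p v.
Proof. by rewrite path_act_pi /fpath_act flift_basis. Qed.

Lemma path_act_bilinear i j : bilinear (@path_act i j).
Proof.
have [aDl aDr] := fpath_act_bilinear i j.
split=> [v c x y|x c u v].
  have [x' ->] := lqpiP x; have [y' ->] := lqpiP y.
  by rewrite -lqpi_linear !path_act_pi aDl.
by rewrite /path_act aDr.
Qed.

Lemma path_actA i j l (a : path_A D Omega i j) (b : path_A D Omega j l) v :
  path_act (path_mul a b) v = path_act a (path_act b v).
Proof.
have [x ->] := lqpiP a; have [y ->] := lqpiP b.
rewrite path_mul_pi !path_act_pi.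
have [aDl aDr] := fpath_act_bilinear i l.
apply: (free_ext (f := fun x => fpath_act (fmul x y) v)
                 (g := fun x => fpath_act x (fpath_act y v))) x => [||p].
- by move=> c u w; rewrite (fmul_bilinear _ _ _ _ _).1 aDl.
- exact: (fpath_act_bilinear _ _).1.
apply: (free_ext (f := fun y => fpath_act (fmul (fpathb p) y) v)
                 (g := fun y => fpath_act (fpathb p) (fpath_act y v))) y
  => [||q].
- by move=> c u w; rewrite (fmul_bilinear _ _ _ _ _).2 aDl.
- move=> c u w.
  by rewrite (fpath_act_bilinear _ _).1 (fpath_act_bilinear _ _).2.
by rewrite fmul_basis /fpath_act !flift_basis opath_act_ocat.
Qed.

Notation rep_sum := (dsum (fun i => am_car (V i))).

Definition rep_act_fun (a : gpath_alg D Omega) (v : rep_sum) (i : I) : V i :=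
  \sum_(s \in [set: I]) path_act (entry a i s) (v s).

Lemma rep_act_seq a (v : rep_sum) i (r : seq I) :
  (forall s, s \notin r -> entry a i s = 0 \/ v s = 0) ->
  rep_act_fun a v i = \sum_(s <- undup r) path_act (entry a i s) (v s).
Proof.
have bl := path_act_bilinear.
by move=> r0; apply: fsum_seq => s /r0[] ->; rewrite (bil0l, bil0r).
Qed.

Lemma rep_act_fin a (v : rep_sum) :
  finite_set [set i | rep_act_fun a v i != 0].
Proof.
have [r ar] := dsum_suppP (a : dsum _).
apply: (@dsum_fin_seq _ _ _ _ [seq p.1 | p <- r]) => i ir.
rewrite (@rep_act_seq _ _ _ [::]) ?big_nil // => s _; left.
by apply: (ar (i, s)); apply: contraNN ir => /(map_f fst).
Qed.

Definition rep_act (a : gpath_alg D Omega) (v : rep_sum) : rep_sum :=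
  DSum (rep_act_fin a v).

Lemma rep_act_bilinear : bilinear rep_act.
Proof.
split=> [v c a b|a c u v]; apply: dsum_ext => i /=.
  have [r vr] := dsum_suppP v.
  rewrite !(@rep_act_seq _ v _ r); try by move=> s /vr ->; right.
  rewrite scaler_sumr -big_split; apply: eq_bigr => s _ /=.
  exact: (path_act_bilinear _ _).1.
have [r ar] := gpath_row a i.
rewrite !(@rep_act_seq a _ _ r); try by move=> s /ar; left.
rewrite scaler_sumr -big_split; apply: eq_bigr => s _ /=.
exact: (path_act_bilinear _ _).2.
Qed.

Lemma rep_actA a b v : rep_act (nmul a b) v = rep_act a (rep_act b v).
Proof.
apply: dsum_ext => i /=.
have [r ar] := gpath_row a i; have [t vt] := dsum_suppP v.
rewrite (@rep_act_seq _ _ _ t); last by move=> s /vt; right.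
rewrite (@rep_act_seq _ _ _ r); last by move=> s /ar; left.
under eq_bigr => s _.
  rewrite {1}/entry /= (@gpath_mul_seq _ _ _ _ _ _ _ r); last first.
    by move=> u /ar; left.
  rewrite (bil_suml (path_act_bilinear _ _)).
  over.
rewrite exchange_big /=; apply: eq_bigr => u _.
rewrite (@rep_act_seq _ _ _ t); last by move=> s /vt; right.
rewrite (bil_sumr (path_act_bilinear _ _)).
by apply: eq_bigr => s _; rewrite path_actA.
Qed.

Definition rep_module : amodule (gpath_alg D Omega) :=
  AModule rep_act_bilinear rep_actA.

End Action.

(* [act sigma : rep_module V -> rep_module V] is f_sigma. *)
Definition satisfies (rho : set (gpath_alg D Omega)) (V : rep_category) :
  Prop :=
  forall sigma, rho sigma -> forall v : rep_module V, act sigma v = 0.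

Definition rep_rel_category (rho : set (gpath_alg D Omega)) : category :=
  full_subcategory (satisfies rho).

Definition fd_rep (rho : set (gpath_alg D Omega)) (V : rep_rel_category rho) :
  Prop :=
  finite_dimensional (rep_module (sval V)).

Definition fd_rep_rel_category (rho : set (gpath_alg D Omega)) : category :=
  full_subcategory (@fd_rep rho).

End Representations.

(* Main.v *)
From HB Require Import structures.
Require Import Defs.
From mathcomp Require Import all_boot all_order all_algebra.
From mathcomp Require Import boolp classical_sets functions fsbigop cardinality.
(* The names [hom] and [comp] are to mean those of categories, not those of
   linear maps and functions. *)
Import Defs.

Set Implicit Arguments.
Unset Strict Implicit.
Unset Printing Implicit Defensive.

Import GRing.Theory.
Local Open Scope ring_scope.
Local Open Scope classical_set_scope.

(** The equivalence sends a representation V to the direct sum of the V_i, on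
which k(D,Omega) acts by paths; the ideal (rho) kills this sum exactly when V
satisfies the relations, so it is a module over the quotient. The vertices give
orthogonal idempotents e_i, and every element of the path algebra is fixed on
the left by a finite sum of them. This is the mechanism of the whole proof:
e_i acts on the sum as the projection to V_i.

- The sum is local unitary, since v is fixed by the sum of the e_i over its
  support ([rep_module_local_unitary]).
- The functor is fully faithful: a module map commutes with the e_i, hence is
  diagonal, and commuting with vertices and arrows says that its components
  form a morphism of representations ([hom_components],
  [rep_hom_sum_components]).
- It is essentially surjective: from a module M one gets the representation
  with V_i = e_i M, on which arrows act through M ([module_rep]). The sum map
  from the direct sum of the e_i M to M is a homomorphism ([vertex_sum_act]),
  injective by orthogonality. If M is local unitary it is onto: x = a x for
  some a, and a is a finite sum of the e_i a ([componentsK]). Injectivity also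
  transports the relations from M to this representation.

The functor does not change the underlying vector space and the sum map is a
linear isomorphism, so finite dimensional objects correspond to each other and
the equivalence restricts to them. *)

(** * Equivalences of categories *)

Section FullyFaithful.
(* Full faithfulness is given by an inverse [lift] on morphisms, and essential
   surjectivity by a chosen preimage [G d] with an isomorphism [eps d]; G is
   then made a functor in the only way that makes eps natural. *)
Variables (C D : category) (F : functor C D).
Variable lift : forall a b, hom (F a) (F b) -> hom a b.
Hypothesis liftK : forall a b (g : hom (F a) (F b)), fmap F (lift g) = g.
Hypothesis fmapK : forall a b (f : hom a b), lift (fmap F f) = f.
Variables (G : D -> C) (eps : forall d, hom (F (G d)) d).
Variable eps' : forall d, hom d (F (G d)).
Hypothesis epsK : forall d, comp (eps' d) (eps d) = idc (F (G d)).
Hypothesis eps'K : forall d, comp (eps d) (eps' d) = idc d.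

Let fmap_inj a b (f g : hom a b) : fmap F f = fmap F g -> f = g.
Proof. by move=> fg; rewrite -[f]fmapK fg fmapK. Qed.

Definition inverse_map d d' (g : hom d d') : hom (G d) (G d') :=
  lift (comp (eps' d') (comp g (eps d))).

Lemma inverse_map_id d : inverse_map (idc d) = idc (G d).
Proof. by apply: fmap_inj; rewrite liftK comp_idl epsK fmap_id. Qed.

Lemma inverse_map_comp d d' d'' (g : hom d' d'') (h : hom d d') :
  inverse_map (comp g h) = comp (inverse_map g) (inverse_map h).
Proof.
apply: fmap_inj; rewrite fmap_comp !liftK -!compA; congr (comp _ _).
by congr (comp _ _); rewrite compA [in RHS]compA eps'K comp_idl.
Qed.

Definition inverse_functor : functor D C :=
  Functor inverse_map_id inverse_map_comp.

Lemma equivalent_of_fully_faithful : equivalent C D.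
Proof.
exists F, inverse_functor; split; constructor.
  apply: (@NatIso C C (compfunctor inverse_functor F) (idfunctor C)
    (fun a => lift (eps (F a))) (fun a => lift (eps' (F a)))).
  - move=> a b f; apply: fmap_inj; rewrite /= !fmap_comp !liftK.
    by rewrite compA eps'K comp_idl.
  - by move=> a; apply: fmap_inj; rewrite /= fmap_comp !liftK epsK fmap_id.
  - by move=> a; apply: fmap_inj; rewrite /= fmap_comp !liftK eps'K fmap_id.
apply: (@NatIso D D (compfunctor F inverse_functor) (idfunctor D) eps eps').
- by move=> a b f; rewrite /= liftK compA eps'K comp_idl.
- exact: epsK.
- exact: eps'K.
Qed.

End FullyFaithful.

Section FullSubcategory.
Variables (C D : category) (F : functor C D) (P : C -> Prop) (Q : D -> Prop).
Hypothesis FP : forall a, P a -> Q (F a).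

Definition restrict_obj (a : full_subcategory P) : full_subcategory Q :=
  exist Q (F (sval a)) (FP (svalP a)).

Definition restrict_functor :
    functor (full_subcategory P) (full_subcategory Q) :=
  @Functor (full_subcategory P) (full_subcategory Q) restrict_obj
    (fun a b f => @fmap _ _ F (sval a) (sval b) f)
    (fun a => fmap_id F (sval a))
    (fun a b c f g => @fmap_comp _ _ F (sval a) (sval b) (sval c) f g).

End FullSubcategory.

(** The data of [equivalent_of_fully_faithful] restrict to full subcategories
as soon as both object maps respect them, which is how the finite dimensional
case follows from the general one. *)
Lemma equivalent_full_subcategory (C D : category) (F : functor C D)
    (lift : forall a b, hom (F a) (F b) -> hom a b)
    (G : D -> C) (eps : forall d, hom (F (G d)) d)
    (eps' : forall d, hom d (F (G d))) (P : C -> Prop) (Q : D -> Prop) :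
  (forall a b (g : hom (F a) (F b)), fmap F (lift a b g) = g) ->
  (forall a b (f : hom a b), lift a b (fmap F f) = f) ->
  (forall d, comp (eps' d) (eps d) = idc (F (G d))) ->
  (forall d, comp (eps d) (eps' d) = idc d) ->
  (forall a, P a -> Q (F a)) -> (forall d, Q d -> P (G d)) ->
  equivalent (full_subcategory P) (full_subcategory Q).
Proof.
move=> liftK fmapK epsK eps'K FP GQ.
apply: (@equivalent_of_fully_faithful (full_subcategory P) (full_subcategory Q)
  (restrict_functor FP) (fun a b => lift (sval a) (sval b)) _ _
  (fun d => exist P (G (sval d)) (GQ _ (svalP d)))
  (fun d => eps (sval d)) (fun d => eps' (sval d))).
- by move=> a b g; exact: liftK.
- by move=> a b f; exact: fmapK.
- by move=> d; exact: epsK.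
- by move=> d; exact: eps'K.
Qed.

(** * Direct sums *)

Lemma linear_at0 (k : fieldType) (V W : lmodType k) (f : V -> W) :
  linear f -> f 0 = 0.
Proof.
by move=> fl; have := fl (-1) 0 0; rewrite scaler0 addr0 scaleN1r addNr.
Qed.

Section DirectSums.
Variables (k : fieldType) (I : choiceType) (V : I -> lmodType k).

Lemma dsin_in i (v : V i) : dsin v i = v.
Proof. exact: dfwith_in. Qed.

Lemma dsin_out i j (v : V i) : i != j -> dsin v j = 0.
Proof. by move=> ij; rewrite /= dfwith_out. Qed.

Lemma dsin_linear i : linear (@dsin k I V i).
Proof.
move=> c u v; apply: dsum_ext => j; rewrite dsumDE dsumZE.
have [<-|ij] := eqVneq i j; first by rewrite !dsin_in.
by rewrite !dsin_out // scaler0 addr0.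
Qed.

Lemma dsum_sum (x : dsum V) (r : seq I) : (forall i, i \notin r -> x i = 0) ->
  x = \sum_(i <- undup r) dsin (x i).
Proof.
move=> x0; apply: dsum_ext => j; rewrite dsum_sumE.
have [jr|jr] := boolP (j \in r); last first.
  rewrite x0 // big_seq big1 // => i; rewrite mem_undup => ir.
  by rewrite dsin_out //; apply: contraNneq jr => <-.
rewrite (bigD1_seq j) ?undup_uniq ?mem_undup //= dfwith_in.
by rewrite big1 ?addr0 // => i ij; rewrite dfwith_out.
Qed.

Lemma linear_dsum_ext (W : lmodType k) (f g : dsum V -> W) :
    linear f -> linear g -> (forall i (v : V i), f (dsin v) = g (dsin v)) ->
  forall x, f x = g x.
Proof.
move=> fl gl fg x; have [r /dsum_sum ->] := dsum_suppP x.
pose f' : {linear dsum V -> W} :=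
  HB.pack f (GRing.isLinear.Build k (dsum V) W _ f fl).
pose g' : {linear dsum V -> W} :=
  HB.pack g (GRing.isLinear.Build k (dsum V) W _ g gl).
rewrite -[f]/(f' : _ -> _) -[g]/(g' : _ -> _) !linear_sum.
by apply: eq_bigr => i _; exact: fg.
Qed.

Section Copairing.
Variables (W : lmodType k) (g : forall i, V i -> W).
Hypothesis gl : forall i, linear (@g i).

Let g0 i : g (0 : V i) = 0. Proof. exact: linear_at0. Qed.

Definition copair (x : dsum V) : W := \sum_(i \in [set: I]) g (x i).

Lemma copair_seq (x : dsum V) (r : seq I) :
  (forall i, i \notin r -> x i = 0) ->
  copair x = \sum_(i <- undup r) g (x i).
Proof. by move=> x0; apply: fsum_seq => i /x0 ->. Qed.

Lemma copair_linear : linear copair.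
Proof.
move=> c x y; have [r xr] := dsum_suppP x; have [s ys] := dsum_suppP y.
have rs i : i \notin r ++ s -> x i = 0 /\ y i = 0.
  by rewrite mem_cat negb_or => /andP[/xr -> /ys ->].
rewrite !(@copair_seq _ (r ++ s)); first last.
- by move=> i /rs[xi yi]; rewrite dsumDE dsumZE xi yi scaler0 addr0.
- by move=> i /rs[].
- by move=> i /rs[].
by rewrite scaler_sumr -big_split; apply: eq_bigr => i _; rewrite /= gl.
Qed.

Lemma copair_dsin i (v : V i) : copair (dsin v) = g v.
Proof.
rewrite (@copair_seq _ [:: i]) /= ?big_seq1 ?dfwith_in //.
by move=> j; rewrite inE eq_sym => ij; rewrite dfwith_out.
Qed.

End Copairing.
End DirectSums.

(** * Modules over a quotient algebra *)

Section Restriction.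
Variables (k : fieldType) (A : nualg k) (S : set A).
Local Notation Q := (quotient_alg S).
Local Notation pi := (lqpi (ideal_gen S)).

Section Inflate.
Variable M : amodule Q.
Lemma inflate_bilinear : bilinear (fun (a : A) (v : M) => @act k Q M (pi a) v).
Proof.
split=> [v c a b|a]; last exact: (act_bilinear M).2.
by rewrite lqpi_linear (act_bilinear M).1.
Qed.
Lemma inflateA a b (v : M) :
  @act k Q M (pi (nmul a b)) v = @act k Q M (pi a) (@act k Q M (pi b) v).
Proof. by rewrite -(@actA k Q M) /= qmul_pi. Qed.
Definition inflate : amodule A := AModule inflate_bilinear inflateA.
End Inflate.

Section Descend.
Variable M : amodule A.
Hypothesis MS : forall s, S s -> forall v : M, act s v = 0.

(** The annihilator of a module is a two-sided ideal, so it contains the ideal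
generated by any of its subsets. *)
Lemma ideal_gen_act0 a : a \in ideal_gen S -> forall v : M, act a v = 0.
Proof.
move=> /asboolP.
have bl := act_bilinear M.
pose K : {pred A} := fun a => `[< forall v : M, act a v = 0 >].
have Kc : submod_closed K.
  split=> [|c x y /asboolP x0 /asboolP y0]; apply/asboolP => v.
    exact: bil0l.
  by rewrite bl.1 x0 y0 scaler0 addr0.
pose K' : submodClosed A := HB.pack K (GRing.isSubmodClosed.Build k A K Kc).
move=> /(_ K') aK; apply/asboolP; apply: aK => [b x /asboolP x0|y Sy].
  by split; apply/asboolP => v; rewrite actA x0 // (bil0r bl).
by apply/asboolP; exact: MS.
Qed.

Definition descend_act (q : Q) (v : M) : M :=
  act (repr (q : lquot (ideal_gen S))) v.

Lemma descend_act_pi a v : descend_act (pi a) v = act a v.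
Proof.
have h : repr (pi a) - a \in ideal_gen S by apply/lqpi_eq; rewrite /lqpi reprK.
rewrite /descend_act -[in LHS](subrK a (repr (pi a))).
rewrite -[_ - a]scale1r (act_bilinear M).1 ideal_gen_act0 //.
by rewrite scaler0 add0r.
Qed.

Lemma descend_bilinear : bilinear descend_act.
Proof.
split=> [v c q r|q]; last exact: (act_bilinear M).2.
have [a ->] := lqpiP q; have [b ->] := lqpiP r.
by rewrite -lqpi_linear !descend_act_pi (act_bilinear M).1.
Qed.

Lemma descendA q r v :
  descend_act (nmul q r) v = descend_act q (descend_act r v).
Proof.
have [a ->] := lqpiP q; have [b ->] := lqpiP r.
by rewrite /= qmul_pi !descend_act_pi actA.
Qed.

Definition descend : amodule Q := AModule descend_bilinear descendA.

Lemma descend_actE a (v : M) : @act k Q descend (pi a) v = act a v.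
Proof. exact: descend_act_pi. Qed.
End Descend.

Lemma inflate_local_unitary (M : amodule Q) :
  local_unitary M -> local_unitary (inflate M).
Proof.
move=> Mlu v; have [q qv] := Mlu v.
by have [a qE] := lqpiP q; exists a; rewrite /= -qE.
Qed.

Lemma descend_local_unitary (M : amodule A)
    (MS : forall s, S s -> forall v : M, act s v = 0) :
  local_unitary M -> local_unitary (descend MS).
Proof.
move=> Mlu v; have [a av] := Mlu v.
by exists (pi a); rewrite -[RHS]av; exact: descend_act_pi.
Qed.

(* Linearity over the quotient need only be checked on classes of elements of
   A, where it is linearity over A. *)
Section QuotientHom.
Variables (M N : amodule Q) (f : M -> N).
Hypotheses (f_linear : linear f)
  (f_act : forall a v, f (@act k Q M (pi a) v) = @act k Q N (pi a) (f v)).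

Lemma quotient_hom_act (q : Q) v : f (act q v) = act q (f v).
Proof. by have [a ->] := lqpiP q; exact: f_act. Qed.

Definition quotient_hom : ahom M N := AHom f_linear quotient_hom_act.
End QuotientHom.
End Restriction.

(** * Corners of a module *)

Section Corner.
Variables (k : fieldType) (A : nualg k) (M : amodule A) (e : A).

(** For an idempotent e this is e M; being fixed is an equation, so
no witness has to be carried along. *)
Definition fixed_pred : {pred M} := fun x => act e x == x.

Lemma fixed_submod_closed : submod_closed fixed_pred.
Proof.
split=> [|c u v /eqP eu /eqP ev]; apply/eqP.
  exact: (bil0r (act_bilinear M)).
by rewrite (act_bilinear M).2 eu ev.
Qed.

HB.instance Definition _ := GRing.isSubmodClosed.Build k M fixed_pred
  fixed_submod_closed.

Record fixed_space := Fixed {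
  fixed_val :> M; fixed_valP : fixed_val \in fixed_pred }.

HB.instance Definition _ := [isSub for fixed_val].
HB.instance Definition _ := [Choice of fixed_space by <:].
HB.instance Definition _ := [SubChoice_isSubLmodule of fixed_space by <:].

Lemma fixed_valE (x : fixed_space) : act e (fixed_val x) = x.
Proof. exact/eqP/fixed_valP. Qed.

Lemma fixed_val_linear : linear fixed_val.
Proof. by []. Qed.
End Corner.

(* An algebra R embedded in A with unity e = iota 1 acts on the corner e M, and
   there its unity acts as the identity. *)
Section CornerModule.
Variables (k : fieldType) (A : nualg k) (R : algType k) (iota : R -> A).
Hypothesis iota_linear : linear iota.
Hypothesis iotaM : forall a b, iota (a * b) = nmul (iota a) (iota b).
Variable M : amodule A.
Local Notation V := (fixed_space M (iota 1)).

Lemma corner_act_fixed a (x : V) :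
  act (iota a) (fixed_val x) \in @fixed_pred k A M (iota 1).
Proof. by apply/eqP; rewrite -actA -iotaM mul1r. Qed.

Definition corner_act (a : alg_nualg R) (x : V) : V :=
  Fixed (corner_act_fixed a x).

Lemma corner_bilinear : bilinear corner_act.
Proof.
split=> [x c a b|a c x y]; apply: val_inj => /=.
  by rewrite iota_linear (act_bilinear M).1.
exact: (act_bilinear M).2.
Qed.

Lemma cornerA a b x :
  corner_act (nmul a b) x = corner_act a (corner_act b x).
Proof. by apply: val_inj; rewrite /= iotaM actA. Qed.

Definition corner : amodule (alg_nualg R) := AModule corner_bilinear cornerA.

Lemma corner_unitary : unitary corner.
Proof. by move=> x; apply: val_inj; exact: fixed_valE. Qed.

End CornerModule.

(** * Products in the generalized path algebra *)

Section PathProducts.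
Variables (k : fieldType) (I : choiceType) (D : I -> I -> Type).
Variable Omega : I -> algType k.
Local Notation A := (gpath_alg D Omega).

(** The summand A_ij inside k(D,Omega). *)
Definition piece i j (b : path_A D Omega i j) : A :=
  @dsin k _ (fun p : I * I => path_A D Omega p.1 p.2) (i, j) b.

Lemma piece_linear i j : linear (@piece i j).
Proof.
exact: (@dsin_linear k _ (fun p : I * I => path_A D Omega p.1 p.2) (i, j)).
Qed.

Lemma olmul1 i j (p : opath D Omega i j) : olmul 1 p = p.
Proof. by case: p => [? a|? ? ? a x p]; rewrite /= mul1r. Qed.

Lemma entry_piece i j (b : path_A D Omega i j) : entry (piece b) i j = b.
Proof.
exact: (@dsin_in k _ (fun p : I * I => path_A D Omega p.1 p.2) (i, j)).
Qed.

Lemma entry_piece_out i j (b : path_A D Omega i j) l m :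
  (i, j) != (l, m) -> entry (piece b) l m = 0.
Proof.
exact: (@dsin_out k _ (fun p : I * I => path_A D Omega p.1 p.2)
  (i, j) (l, m)).
Qed.

Lemma nmul_piecel i j (b : path_A D Omega i j) (x : A) l :
  entry (nmul (piece b) x) i l = path_mul b (entry x j l).
Proof.
rewrite {1}/entry /= (@gpath_mul_seq _ _ _ _ _ _ _ [:: j]) /=.
  by rewrite big_seq1 -[_ (i, j)]/(entry (piece b) i j) entry_piece.
move=> s; rewrite inE eq_sym => js; left; apply: entry_piece_out.
by apply: contraNneq js => -[<-].
Qed.

Lemma nmul_piecel_out i j (b : path_A D Omega i j) (x : A) h l : i != h ->
  entry (nmul (piece b) x) h l = 0.
Proof.
move=> ih; rewrite {1}/entry /= (@gpath_mul_seq _ _ _ _ _ _ _ [::]) ?big_nil //.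
move=> s _; left; apply: entry_piece_out.
by apply: contraNneq ih => -[<-].
Qed.

Lemma nmul_piece i j l (b : path_A D Omega i j) (c : path_A D Omega j l) :
  nmul (piece b) (piece c) = piece (path_mul b c).
Proof.
apply: dsum_ext => -[h m].
rewrite -[LHS]/(entry (nmul (piece b) (piece c)) h m).
rewrite -[RHS]/(entry (piece (path_mul b c)) h m).
have [<-{h}|ih] := eqVneq i h; last first.
  rewrite nmul_piecel_out // entry_piece_out //.
  by apply: contraNneq ih => -[<-].
rewrite nmul_piecel.
have [<-{m}|lm] := eqVneq l m; first by rewrite !entry_piece.
have jlm : (j, l) != (j, m) by apply: contraNneq lm => -[<-].
have ilm : (i, l) != (i, m) by apply: contraNneq lm => -[<-].
rewrite (entry_piece_out c jlm) (entry_piece_out _ ilm).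
exact: bil0r (path_mul_bilinear D Omega _ _ _) b.
Qed.

Lemma gpath_elt_mul i j l (p : opath D Omega i j) (q : opath D Omega j l) :
  nmul (gpath_elt p) (gpath_elt q) = gpath_elt (ocat p q).
Proof. by rewrite [LHS]nmul_piece path_mul_cls. Qed.

Definition vertex_emb i (a : Omega i) : A := gpath_elt (OPpoint D a).

Lemma vertex_emb_linear i : linear (@vertex_emb i).
Proof.
move=> c a b; rewrite /vertex_emb /gpath_elt path_cls_pointD.
exact: piece_linear.
Qed.

Lemma vertex_embM i (a b : Omega i) :
  vertex_emb (a * b) = nmul (vertex_emb a) (vertex_emb b).
Proof. by rewrite [RHS]gpath_elt_mul. Qed.

Local Notation idem i := (@vertex_emb i 1).

Lemma path_mul1l i j (b : path_A D Omega i j) :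
  path_mul (path_cls (OPpoint D (1 : Omega i))) b = b.
Proof.
have [x ->] := lqpiP b; rewrite path_mul_pi; congr lqpi.
apply: (free_ext (f := fmul (fpathb (OPpoint D (1 : Omega i)))) (g := id)) x.
- exact: (fmul_bilinear D Omega _ _ _).2.
- by [].
by move=> p; rewrite [LHS]fmul_basis /= olmul1.
Qed.

Lemma ocat1 i j (p : opath D Omega i j) : ocat p (OPpoint D 1) = p.
Proof. by elim: p => [? a|? ? ? a x p IH] /=; rewrite ?mulr1 ?IH. Qed.

Lemma path_mul1r i j (b : path_A D Omega i j) :
  path_mul b (path_cls (OPpoint D (1 : Omega j))) = b.
Proof.
have [x ->] := lqpiP b; rewrite path_mul_pi; congr lqpi.
apply: (free_ext (f := fun x => fmul x (fpathb (OPpoint D (1 : Omega j))))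
  (g := id)) x.
- exact: (fmul_bilinear D Omega _ _ _).1.
- by [].
by move=> p; rewrite [LHS]fmul_basis ocat1.
Qed.

Lemma idem_piece i j (b : path_A D Omega i j) :
  nmul (idem i) (piece b) = piece b.
Proof. by rewrite [LHS]nmul_piece path_mul1l. Qed.

Lemma piece_idem i j (b : path_A D Omega i j) :
  nmul (piece b) (idem j) = piece b.
Proof. by rewrite [LHS]nmul_piece path_mul1r. Qed.

Lemma idem_orth i j : i != j -> nmul (idem i) (idem j) = 0.
Proof.
move=> ij; apply: dsum_ext => -[h l].
rewrite -[LHS]/(entry (nmul (idem i) (idem j)) h l).
have [<-{h}|ih] := eqVneq i h; last exact: nmul_piecel_out.
rewrite [LHS]nmul_piecel entry_piece_out.
  exact: bil0r (path_mul_bilinear D Omega _ _ _) _.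
by apply: contraNneq ij => -[<-].
Qed.

(** Paths are products of vertex entries and arrows, which reduces the action of
a path on a module to those of vertices and arrows. *)
Lemma gpath_elt_cons i j l (a : Omega i) (x : D i j) (p : opath D Omega j l) :
  gpath_elt (OPcons a x p)
  = nmul (vertex_emb a) (nmul (arrow_elt Omega x) (gpath_elt p)).
Proof. by rewrite !gpath_elt_mul /= mulr1 olmul1. Qed.

(** Only finitely many rows of x are nonzero, and e_i x is row i. This is where
local unitarity gets its finiteness from. *)
Lemma idem_finite (x : A) :
  exists r : seq I, forall i, i \notin r -> nmul (idem i) x = 0.
Proof.
have [r xr] := dsum_suppP (x : dsum _).
exists [seq p.1 | p <- r] => i ir; apply: dsum_ext => -[h l].
rewrite -[LHS]/(entry (nmul (idem i) x) h l).
have [<-{h}|ih] := eqVneq i h; last by rewrite nmul_piecel_out.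
rewrite nmul_piecel [entry _ _ _]xr.
  exact: bil0r (path_mul_bilinear D Omega _ _ _) _.
by apply: contraNN ir => /(map_f fst).
Qed.

(** * From representations to modules *)

Section RepModule.
Variable V : rep D Omega.

Lemma piece_act i j (b : path_A D Omega i j) (v : rep_module V) :
  act (piece b) v = dsin (path_act b ((v : dsum _) j)) :> dsum _.
Proof.
apply: dsum_ext => h /=; have [<-{h}|ih] := eqVneq i h; last first.
  rewrite dfwith_out // (@rep_act_seq _ _ _ _ _ _ _ _ [::]) ?big_nil //.
  move=> s _; left; apply: entry_piece_out.
  by apply: contraNneq ih => -[<-].
rewrite dfwith_in (@rep_act_seq _ _ _ _ _ _ _ _ [:: j]) /=.
  by rewrite big_seq1 dfwith_in.
move=> s; rewrite inE eq_sym => js; left; apply: entry_piece_out.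
by apply: contraNneq js => -[<-].
Qed.

Lemma gpath_elt_act i j (p : opath D Omega i j) (v : rep_module V) :
  act (gpath_elt p) v = dsin (opath_act p ((v : dsum _) j)) :> dsum _.
Proof. by rewrite [LHS]piece_act path_act_cls. Qed.

Lemma idem_act i (v : rep_module V) :
  act (idem i) v = dsin ((v : dsum _) i) :> dsum _.
Proof. by rewrite [LHS]gpath_elt_act /= rep_unitary. Qed.

(** A vector is fixed by the sum of the idempotents over its support. *)
Lemma rep_module_local_unitary : local_unitary (rep_module V).
Proof.
move=> v; have [r vr] := dsum_suppP (v : dsum _).
exists (\sum_(i <- undup r) idem i).
by rewrite (bil_suml (act_bilinear (rep_module V))) [RHS](dsum_sum vr);
  apply: eq_bigr => i _; exact: idem_act.
Qed.

End RepModule.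

Section RepHomSum.
Variables (V W : rep D Omega) (h : rep_hom V W).

Lemma path_act_hom i j (b : path_A D Omega i j) (v : V j) :
  h i (path_act b v) = path_act b (h j v).
Proof.
have [x ->] := lqpiP b; rewrite !path_act_pi.
apply: (free_ext (f := fun x => h i (fpath_act x v))
                 (g := fun x => fpath_act x (h j v))) x => [c u w||p].
- by rewrite (fpath_act_bilinear _ _ _).1 ahom_linear.
- exact: (fpath_act_bilinear _ _ _).1.
rewrite /fpath_act !flift_basis; elim: p v => [? a|? ? ? a x p IH] v /=.
  exact: ahom_act.
by rewrite -IH -rep_hom_comm; exact: ahom_act.
Qed.

Lemma rep_hom_sum_fin (v : rep_module V) :
  finite_set [set i | h i ((v : dsum _) i) != 0].
Proof.
have [r vr] := dsum_suppP (v : dsum _).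
apply: (@dsum_fin_seq _ _ _ _ r) => i /vr ->.
exact: linear_at0 (ahom_linear (h i)).
Qed.

Definition rep_hom_sum (v : rep_module V) : rep_module W :=
  DSum (rep_hom_sum_fin v).

Lemma rep_hom_sum_linear : linear rep_hom_sum.
Proof. by move=> c u v; apply: dsum_ext => i /=; exact: ahom_linear. Qed.

Lemma rep_hom_sum_dsin i (v : V i) : rep_hom_sum (dsin v) = dsin (h i v).
Proof.
apply: dsum_ext => j /=; have [<-{j}|ij] := eqVneq i j.
  by rewrite !dfwith_in.
by rewrite !dfwith_out // (linear_at0 (ahom_linear (h j))).
Qed.

Lemma rep_hom_sum_act a (v : rep_module V) :
  rep_hom_sum (act a v) = act a (rep_hom_sum v).
Proof.
apply: (linear_dsum_ext (f := fun a : A => rep_hom_sum (act a v))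
  (g := fun a : A => act a (rep_hom_sum v))) a.
- by move=> c a b; rewrite (act_bilinear (rep_module V)).1 rep_hom_sum_linear.
- exact: (act_bilinear (rep_module W)).1.
move=> [i j] b; rewrite [act _ v](piece_act b v) rep_hom_sum_dsin.
by rewrite [RHS](piece_act b) path_act_hom.
Qed.

End RepHomSum.

Section HomComponents.
Variables (V W : rep D Omega) (f : rep_module V -> rep_module W).
Hypotheses (f_linear : linear f)
  (f_act : forall (a : A) v, f (act a v) = act a (f v)).
Local Notation inV i v := (@dsin k I (fun j => V j) i v).
Local Notation inW i v := (@dsin k I (fun j => W j) i v).

Definition hom_component i (v : V i) : W i := (f (inV i v) : dsum _) i.

(** A module map commutes with the idempotents, so it preserves the summand of
each vertex. *)
Lemma hom_componentE i (v : V i) : f (inV i v) = inW i (hom_component v).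
Proof. by rewrite -[RHS]idem_act -f_act [X in _ = f X]idem_act dsin_in. Qed.

(** Applied to paths of length 0 this gives linearity over the algebra of the
vertex, and applied to a single arrow it gives compatibility with that arrow. *)
Lemma hom_component_gpath i j (p : opath D Omega i j) v :
  hom_component (opath_act p v) = opath_act p (hom_component v).
Proof.
have E : act (gpath_elt p) (inV j v : rep_module V) = inV i (opath_act p v).
  by rewrite [LHS]gpath_elt_act dsin_in.
by rewrite /hom_component -E f_act [act _ _]gpath_elt_act dsin_in.
Qed.

Lemma hom_component_linear i : linear (@hom_component i).
Proof. by move=> c u v; rewrite /hom_component dsin_linear f_linear. Qed.

Lemma hom_component_act i (a : alg_nualg (Omega i)) (v : V i) :
  hom_component (act a v) = act a (hom_component v).
Proof. exact: (hom_component_gpath (OPpoint D a)). Qed.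

Lemma hom_component_arrow i j (x : D i j) (v : V j) :
  hom_component (rep_map V x v) = rep_map W x (hom_component v).
Proof.
have := hom_component_gpath (OPcons 1 x (OPpoint D 1)) v.
by rewrite /= !rep_unitary.
Qed.

Definition hom_components : rep_hom V W :=
  @RepHom k I D Omega V W
    (fun i => AHom (@hom_component_linear i) (@hom_component_act i))
    hom_component_arrow.

Lemma rep_hom_sum_components v : rep_hom_sum hom_components v = f v.
Proof.
apply: (linear_dsum_ext (f := rep_hom_sum hom_components) (g := f)) => //.
  exact: rep_hom_sum_linear.
by move=> i w; rewrite rep_hom_sum_dsin [RHS]hom_componentE.
Qed.
End HomComponents.
End PathProducts.

(** * From modules to representations *)

Section Reconstruction.
Variables (k : fieldType) (I : choiceType) (D : I -> I -> Type).
Variable Omega : I -> algType k.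
Local Notation A := (gpath_alg D Omega).
Local Notation idem i := (vertex_emb D (1 : Omega i)).
Variable M : amodule A.

Definition vertex_module i : amodule (alg_nualg (Omega i)) :=
  corner (vertex_emb_linear D (i := i)) (@vertex_embM _ _ D Omega i) M.

Section Arrow.
Variables (i j : I) (x : D i j).

Lemma arrow_act_fixed (v : vertex_module j) :
  act (arrow_elt Omega x) (fixed_val v) \in @fixed_pred k A M (idem i).
Proof. by apply/eqP; rewrite -actA idem_piece. Qed.

Definition arrow_act (v : vertex_module j) : vertex_module i :=
  Fixed (arrow_act_fixed v).

Lemma arrow_act_linear : linear arrow_act.
Proof. by move=> c u v; apply: val_inj; exact: (act_bilinear M).2. Qed.

HB.instance Definition _ := GRing.isLinear.Build k (vertex_module j)
  (vertex_module i) _ arrow_act arrow_act_linear.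
End Arrow.

Definition module_rep : rep D Omega :=
  @Rep k I D Omega vertex_module
    (fun i => @corner_unitary _ _ _ _ _ _ M)
    (fun i j x => arrow_act x : {linear vertex_module j -> vertex_module i}).

Definition vertex_sum : rep_module module_rep -> M :=
  copair (fun i (v : module_rep i) => fixed_val v).

Let fl i : linear (fun v : module_rep i => fixed_val v).
Proof. exact: fixed_val_linear. Qed.

Lemma vertex_sum_linear : linear vertex_sum.
Proof. exact: copair_linear fl. Qed.

Lemma vertex_sum_dsin i (v : module_rep i) :
  vertex_sum (@dsin k I (fun j => module_rep j) i v) = fixed_val v.
Proof. exact: (@copair_dsin k I (fun j => module_rep j) M _ fl). Qed.

(** By orthogonality e_i kills the summands at the other vertices, so the sum
determines its terms. *)
Lemma idem_vertex_sum i (v : rep_module module_rep) :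
  act (idem i) (vertex_sum v) = fixed_val ((v : dsum _) i).
Proof.
pose f := fun v : rep_module module_rep => act (idem i) (vertex_sum v).
pose g := fun v : rep_module module_rep => fixed_val ((v : dsum _) i).
apply: (linear_dsum_ext (f := f) (g := g)) v.
- by move=> c u v; rewrite /f vertex_sum_linear (act_bilinear M).2.
- by move=> c u v; exact: fl.
move=> j v; rewrite /f /g vertex_sum_dsin.
have [ij|ij] := eqVneq j i.
  by subst j; rewrite dsin_in; exact: fixed_valE.
rewrite dsin_out // -(fixed_valE v) -actA idem_orth 1?eq_sym //.
by rewrite (bil0l (act_bilinear M)).
Qed.

Lemma vertex_sum_inj : injective vertex_sum.
Proof.
move=> u v uv; apply: dsum_ext => i; apply: val_inj.
by rewrite /= -!idem_vertex_sum uv.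
Qed.

Lemma vertex_opath_act i j (p : opath D Omega i j) (v : module_rep j) :
  fixed_val (opath_act p v) = act (gpath_elt p) (fixed_val v).
Proof.
elim: p v => [? a|? ? ? a x p IH] v //=.
by rewrite IH gpath_elt_cons !actA.
Qed.

Lemma vertex_path_act i j (b : path_A D Omega i j) (v : module_rep j) :
  fixed_val (path_act b v) = act (piece b) (fixed_val v).
Proof.
have [x ->] := lqpiP b; rewrite path_act_pi.
apply: (free_ext (f := fun x => fixed_val (fpath_act x v))
  (g := fun x => act (piece (lqpi (path_B D Omega i j) x)) (fixed_val v))) x
  => [c y z|c y z|p].
- by rewrite (fpath_act_bilinear _ _ _).1 fl.
- by rewrite lqpi_linear piece_linear (act_bilinear M).1.
by rewrite /fpath_act flift_basis; exact: vertex_opath_act.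
Qed.

(** It suffices to act by one summand A_ij, which sees only the component
e_j (vertex_sum v) because its elements are fixed by e_j on the right. *)
Lemma vertex_sum_act a (v : rep_module module_rep) :
  vertex_sum (act a v) = act a (vertex_sum v).
Proof.
apply: (linear_dsum_ext (f := fun a : A => vertex_sum (act a v))
  (g := fun a : A => act a (vertex_sum v))) a.
- move=> c a b; rewrite (act_bilinear (rep_module module_rep)).1.
  exact: vertex_sum_linear.
- exact: (act_bilinear M).1.
move=> [i j] b; rewrite [act _ v](piece_act b v) vertex_sum_dsin.
rewrite vertex_path_act -idem_vertex_sum -actA.
by rewrite piece_idem.
Qed.

Section Components.
Hypothesis Mlu : local_unitary M.

Lemma idem_act_fixed i (x : M) :
  act (idem i) x \in @fixed_pred k A M (idem i).
Proof. by apply/eqP; rewrite -actA idem_piece. Qed.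

Definition component i (x : M) : vertex_module i := Fixed (idem_act_fixed i x).

(** If a x = x, then e_i x = (e_i a) x vanishes for almost all i. *)
Lemma component_suppP (x : M) :
  exists r : seq I, forall i, i \notin r -> component i x = 0.
Proof.
have [a ax] := Mlu x; have [r ar] := idem_finite a.
exists r => i /ar ia; apply: val_inj; rewrite /= -ax -actA ia.
exact: bil0l (act_bilinear M) _.
Qed.

Lemma component_fin x : finite_set [set i | component i x != 0].
Proof. by have [r xr] := component_suppP x; exact: (dsum_fin_seq xr). Qed.

Definition components (x : M) : rep_module module_rep :=
  DSum (component_fin x).

Lemma component_linear i : linear (component i).
Proof. by move=> c x y; apply: val_inj; exact: (act_bilinear M).2. Qed.

Lemma components_linear : linear components.
Proof. by move=> c x y; apply: dsum_ext => i; exact: component_linear. Qed.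

Lemma vertex_sumK : cancel vertex_sum components.
Proof.
by move=> v; apply: dsum_ext => i; apply: val_inj; exact: idem_vertex_sum.
Qed.

(** Writing x = a x, it is enough, by linearity in a, to recover b x for b in a
single A_ij; but b x lies in e_i M and has no other component. *)
Lemma componentsK : cancel components vertex_sum.
Proof.
move=> x; have [a ax] := Mlu x.
rewrite -ax; move: a {ax}; apply: (linear_dsum_ext
  (f := fun a : A => vertex_sum (components (act a x)))
  (g := fun a : A => act a x)).
- move=> c u v.
  by rewrite (act_bilinear M).1 components_linear vertex_sum_linear.
- exact: (act_bilinear M).1.
move=> [i j] /= b; set y : M := act (piece b) x.
change (vertex_sum (components y) = y).
have by0 l : l != i -> component l y = 0.
  move=> li; apply: val_inj => /=.
  by rewrite /y -idem_piece !actA -[act (idem l) _]actA idem_orth //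
    (bil0l (act_bilinear M)).
transitivity (vertex_sum (@dsin k I (fun j => module_rep j) i (component i y))).
  congr vertex_sum; apply: dsum_ext => l.
  have [<-{l}|li] := eqVneq i l; first by rewrite dsin_in.
  by rewrite dsin_out // [LHS]by0 // eq_sym.
by rewrite [LHS]vertex_sum_dsin /= /y -actA idem_piece.
Qed.

Lemma components_act a x : components (act a x) = act a (components x).
Proof. by apply: vertex_sum_inj; rewrite vertex_sum_act !componentsK. Qed.

End Components.
End Reconstruction.

(** * The equivalence *)

Section Equivalence.
Variables (k : fieldType) (I : choiceType) (D : I -> I -> Type).
Variables (Omega : I -> algType k) (rho : set (gpath_alg D Omega)).
Local Notation A := (gpath_alg D Omega).
Local Notation Q := (quotient_alg rho).
Local Notation Reps := (rep_rel_category rho).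
Local Notation Mods := (local_unitary_modules Q).

Definition module_of_rep (V : Reps) : Mods :=
  exist (@local_unitary k Q) (descend (svalP V))
    (descend_local_unitary (@rep_module_local_unitary _ _ _ _ (sval V))).

Lemma module_map_act (V W : Reps) (h : hom V W) a (v : sval (module_of_rep V)) :
  rep_hom_sum h (@act k Q _ (lqpi (ideal_gen rho) a) v)
  = @act k Q (sval (module_of_rep W)) (lqpi (ideal_gen rho) a)
      (rep_hom_sum h v).
Proof. by rewrite !descend_actE rep_hom_sum_act. Qed.

Definition module_map (V W : Reps) (h : hom V W) :
    hom (module_of_rep V) (module_of_rep W) :=
  @quotient_hom k A rho (sval (module_of_rep V)) (sval (module_of_rep W))
    (rep_hom_sum h) (rep_hom_sum_linear h) (module_map_act h).

Lemma module_map_id V : module_map (idc V) = idc (module_of_rep V).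
Proof. by apply: ahom_ext => v; apply: dsum_ext. Qed.

Lemma module_map_comp (U V W : Reps) (g : hom V W) (h : hom U V) :
  module_map (comp g h) = comp (module_map g) (module_map h).
Proof. by apply: ahom_ext => v; apply: dsum_ext. Qed.

Definition module_functor : functor Reps Mods :=
  Functor module_map_id module_map_comp.

Section Lift.
Variables (V W : Reps) (g : hom (module_of_rep V) (module_of_rep W)).

(** The same map, seen on the module over the path algebra itself: passing to
the quotient algebra does not change the carrier. *)
Definition underlying : rep_module (sval V) -> rep_module (sval W) :=
  ahom_fun (g : ahom _ _).

Lemma underlying_linear : linear underlying.
Proof. exact: (ahom_linear (g : ahom _ _)). Qed.

Lemma underlying_act (a : A) v : underlying (act a v) = act a (underlying v).
Proof.
have := @ahom_act k Q _ _ g (lqpi (ideal_gen rho) a) v.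
by rewrite !descend_actE.
Qed.

Definition lift_map : hom V W :=
  hom_components underlying_linear underlying_act.
End Lift.

Lemma lift_mapK (V W : Reps) (g : hom (module_of_rep V) (module_of_rep W)) :
  module_map (lift_map g) = g.
Proof. by apply: ahom_ext => v; exact: rep_hom_sum_components. Qed.

Lemma module_mapK (V W : Reps) (h : hom V W) : lift_map (module_map h) = h.
Proof.
by apply: rep_hom_ext => i v /=; rewrite /hom_component /= dfwith_in.
Qed.

Section EssSurj.
Variable N : Mods.
Local Notation M := (inflate (sval N)).

Let Mlu : local_unitary M. Proof. exact: inflate_local_unitary (svalP N). Qed.

(** The elements of rho act by 0 on N, and the representation embeds in N as a
module. *)
Lemma module_rep_satisfies : satisfies rho (module_rep M).
Proof.
move=> s rs v; apply: vertex_sum_inj.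
have s0 : lqpi (ideal_gen rho) s = 0 by exact: lqpi_mem (mem_ideal_gen rs).
rewrite vertex_sum_act /= s0 (linear_at0 (@vertex_sum_linear _ _ _ _ M)).
exact: bil0l (act_bilinear (sval N)) _.
Qed.

Definition rep_of_module : Reps :=
  exist (satisfies rho) (module_rep M) module_rep_satisfies.

Lemma counit_act a (v : sval (module_of_rep rep_of_module)) :
  vertex_sum (M := M) (@act k Q _ (lqpi (ideal_gen rho) a) v)
  = @act k Q (sval N) (lqpi (ideal_gen rho) a) (vertex_sum v).
Proof. by rewrite descend_actE vertex_sum_act. Qed.

Definition counit : hom (module_of_rep rep_of_module) N :=
  @quotient_hom k A rho (sval (module_of_rep rep_of_module)) (sval N)
    (vertex_sum (M := M)) (@vertex_sum_linear _ _ _ _ M) counit_act.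

Lemma counit_inv_act a (x : sval N) :
  components Mlu (@act k Q _ (lqpi (ideal_gen rho) a) x)
  = @act k Q (sval (module_of_rep rep_of_module)) (lqpi (ideal_gen rho) a)
      (components Mlu x).
Proof. by rewrite descend_actE -components_act. Qed.

Definition counit_inv : hom N (module_of_rep rep_of_module) :=
  @quotient_hom k A rho (sval N) (sval (module_of_rep rep_of_module))
    (components Mlu) (components_linear Mlu) counit_inv_act.

Lemma counitK : comp counit_inv counit = idc (module_of_rep rep_of_module).
Proof. by apply: ahom_ext => v; exact: (vertex_sumK Mlu). Qed.

Lemma counit_invK : comp counit counit_inv = idc N.
Proof. by apply: ahom_ext => x; exact: (componentsK Mlu). Qed.

Lemma rep_of_module_fd : fd_module N -> fd_rep rep_of_module.
Proof.
move=> [n [f f_bij]].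
pose g : {linear rep_module (module_rep M) -> M} :=
  HB.pack (vertex_sum (M := M)) (GRing.isLinear.Build k _ _ _ _
    (@vertex_sum_linear _ _ _ _ M)).
exists n, (f \o g : {linear _ -> _}); apply: bij_comp f_bij _.
exact: Bijective (vertex_sumK Mlu) (componentsK Mlu).
Qed.
End EssSurj.
End Equivalence.

Theorem theorem2p9 (k : fieldType) (I : choiceType) (D : I -> I -> Type)
    (Omega : I -> algType k) (rho : set (gpath_alg D Omega))
    (vertices_nonempty : [set: I] !=set0)
    (Omega_radical : forall i, jacobson_radical (Omega i) = [set 0])
    (rho_nonempty : rho !=set0)
    (rho_weak : weak_relations rho) :
  equivalent (rep_rel_category rho)
             (local_unitary_modules (quotient_alg rho)) /\
  (finite_quiver D ->
   equivalent (fd_rep_rel_category rho)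
              (fd_local_unitary_modules (quotient_alg rho))).
Proof.
split=> [|_].
  apply: (@equivalent_of_fully_faithful _ _ (module_functor rho)
    (@lift_map _ _ _ _ rho) _ _
    (@rep_of_module _ _ _ _ rho) (@counit _ _ _ _ rho)
    (@counit_inv _ _ _ _ rho)).
  - exact: lift_mapK.
  - exact: module_mapK.
  - exact: counitK.
  - exact: counit_invK.
apply: (@equivalent_full_subcategory _ _ (module_functor rho)
  (@lift_map _ _ _ _ rho)
  (@rep_of_module _ _ _ _ rho) (@counit _ _ _ _ rho)
  (@counit_inv _ _ _ _ rho)).
- exact: lift_mapK.
- exact: module_mapK.
- exact: counitK.
- exact: counit_invK.
- by [].
- exact: rep_of_module_fd.
Qed.
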